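(* Let $(\sigma_k)_{k\ge 1}$ satisfy the Polynomial Hypothesis with degree $\beta\ge 0$ (see context). There exist constants $C_*>0$ and $\gamma_0>0$ (not depending on $\theta$, $\gamma$, $\alpha$) such that for all $\theta=(\theta_k)_{k\ge1}\in \ell_2$, all $\gamma\in(0,\gamma_0]$ and all $\alpha>1$, $$\mathbf{E}_\theta\|\tilde\theta(N_{\mathrm{rhm}})-\theta\|^2\le (1+\gamma)\inf_{N\ge 1}R_{\mathrm{rhm}}(\theta,N)+C_*\sigma_1^2\left(\frac{1}{\gamma^{4\beta+1}}+\frac{1}{\alpha-1}\right),$$ where $$R_{\mathrm{rhm}}(\theta,N)=\sum_{k=N+1}^\infty\theta_k^2+\sum_{k=1}^N\sigma_k^2+(1+\alpha)U_0(N),$$ and $N_{\mathrm{rhm}}$ is the data-driven bandwidth defined in the context with the same $\alpha$.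
   Context: Model: one observes $y=(y_k)_{k\ge1}$ with $y_k=\theta_k+\sigma_k\xi_k$, $k=1,2,\dots$, where $\xi_k$ are i.i.d. $\mathcal N(0,1)$, $\theta=(\theta_k)\in\ell_2$ is unknown, and $\sigma_k>0$ are known. $\mathbf{E}_\theta$ is expectation under this model and $\|\cdot\|$ is the $\ell_2$-norm. Polynomial Hypothesis: $(\sigma_k^2)_{k\ge1}$ is a nondecreasing sequence with $\sigma_1^2>0$, and there exist positive constants $C_1,C_2,C_3$ such that for some $\beta\ge0$ (called the degree) and for all $k>1$, $$C_1\left(\frac1{2k}\sum_{i=1}^{2k}\sigma_i^4\right)^{1/2}\le\sigma_k^2\le C_2\sigma_1^2\left(\frac1{\sigma_1^2}\sum_{i=1}^{k-1}\sigma_i^2\right)^{2\beta/(2\beta+1)},$$ and for any integer $s>1$, $$\frac1{\sigma_1^{2s}}\sum_{i=1}^k\sigma_i^{2s}\le C_3^s\left(\frac1{\sigma_1^2}\sum_{i=1}^k\sigma_i^2\right)^{(2s\beta+1)/(2\beta+1)}.$$ Projection estimator with bandwidth $N\ge1$: $\tilde\theta_k(N)=y_k\mathbf 1(k\le N)$, $k\ge1$. Define $\eta_N=\sum_{i=1}^N\sigma_i^2(\xi_i^2-1)$ and $U_0(N)=\inf\{t>0:\mathbf E\,\eta_N\mathbf 1(\eta_N\ge t)\le\sigma_1^2\}$. Risk hull minimization (RHM) bandwidth with parameter $\alpha$: $$N_{\mathrm{rhm}}=N_{\mathrm{rhm}}(y)=\arg\min_{N\ge1}\left\{-\sum_{k=1}^Ny_k^2+2\sum_{k=1}^N\sigma_k^2+(1+\alpha)U_0(N)\right\}.$$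 *)

(* Defs.v *)
(* MathComp-Analysis.  All sequences below are indexed by k >= 1, as in the
   mathematics: they are functions on [nat] whose value at 0 is never used. *)
From HB Require Import structures.
From mathcomp Require Export all_boot all_order all_algebra finmap.
From mathcomp Require Export all_classical all_reals all_analysis.

Set Implicit Arguments.
Unset Strict Implicit.
Unset Printing Implicit Defensive.

Export Order.TTheory GRing.Theory Num.Theory numFieldNormedType.Exports.

Local Open Scope classical_set_scope.
Local Open Scope ring_scope.

Section polynomial_hypothesis.
Context {R : realType}.
Implicit Types (beta : R) (sigma : nat -> R).

Definition polynomial_hypothesis beta sigma : Prop :=
  [/\ 0 <= beta,
      0 < sigma 1%N ^+ 2,
      forall i j, (1 <= i)%N -> (i <= j)%N -> sigma i ^+ 2 <= sigma j ^+ 2 &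
      exists C1 C2 C3 : R,
        [/\ 0 < C1, 0 < C2, 0 < C3 &
         forall k, (1 < k)%N ->
         [/\ C1 * Num.sqrt ((2 * k)%:R^-1 *
                            \sum_(1 <= i < (2 * k).+1) sigma i ^+ 4)
               <= sigma k ^+ 2,
             sigma k ^+ 2 <= C2 * sigma 1%N ^+ 2 *
               ((sigma 1%N ^+ 2)^-1 * \sum_(1 <= i < k) sigma i ^+ 2)
                 `^ (2 * beta / (2 * beta + 1)) &
             forall s, (1 < s)%N ->
               (sigma 1%N ^+ (2 * s))^-1 *
                 \sum_(1 <= i < k.+1) sigma i ^+ (2 * s)
               <= C3 ^+ s *
                  ((sigma 1%N ^+ 2)^-1 * \sum_(1 <= i < k.+1) sigma i ^+ 2)
                    `^ ((2 * s%:R * beta + 1) / (2 * beta + 1))]]].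

End polynomial_hypothesis.

Section sequence_space_model.
Context {d : measure_display} {T : measurableType d} {R : realType}.
Variable P : probability T R.
Implicit Types (xi : nat -> {RV P >-> R}) (sigma theta y : nat -> R).

Definition mutually_independent (I : choiceType) (D : set I)
    (X : I -> {RV P >-> R}) : Prop :=
  forall (J : {fset I}) (B : I -> set R), [set` J] `<=` D ->
    (forall i, i \in J -> measurable (B i)) ->
    P (\bigcap_(i in [set` J]) X i @^-1` B i) =
      (\prod_(i <- J) P (X i @^-1` B i))%E.

(* The laws are compared on Borel sets only: the value of a measure outside
   the sigma-algebra is meaningless. *)
Definition iid_standard_normal xi : Prop :=
  mutually_independent [set k | (1 <= k)%N] xi /\
  forall k, (1 <= k)%N -> forall B : set R, measurable B ->
    distribution P (xi k) B = normal_prob 0 1 B.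

Definition observation sigma theta xi (w : T) : nat -> R :=
  fun k => theta k + sigma k * xi k w.

Definition eta sigma xi (N : nat) (w : T) : R :=
  \sum_(1 <= i < N.+1) sigma i ^+ 2 * (xi i w ^+ 2 - 1).

Definition U0 sigma xi (N : nat) : R :=
  inf [set t : R | 0 < t /\
    ('E_P[fun w => (eta sigma xi N w *
                    \1_[set v | (t <= eta sigma xi N v)%R] w)%R]
       <= (sigma 1%N ^+ 2)%:E)%E].

Definition rhm_criterion sigma xi (alpha : R) y (N : nat) : R :=
  - (\sum_(1 <= k < N.+1) y k ^+ 2) + 2 * \sum_(1 <= k < N.+1) sigma k ^+ 2
  + (1 + alpha) * U0 sigma xi N.

Definition rhm_argmin sigma xi alpha y : set nat :=
  [set N | (1 <= N)%N /\
    forall M, (1 <= M)%N ->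
      rhm_criterion sigma xi alpha y N <= rhm_criterion sigma xi alpha y M].

(* Ties in the arg min may be broken in any (measurable) way, and on the data
   for which the minimum is not attained the value is left unspecified. *)
Definition rhm_bandwidth sigma xi alpha theta (Nrhm : (nat -> R) -> nat) :=
  (forall y, rhm_argmin sigma xi alpha y !=set0 ->
     rhm_argmin sigma xi alpha y (Nrhm y)) /\
  measurable_fun setT (fun w => Nrhm (observation sigma theta xi w)).

Definition proj_estimator y (N : nat) : nat -> R :=
  fun k => if (k <= N)%N then y k else 0.

Definition l2_sqnorm (u : nat -> R) : \bar R :=
  (\sum_(1 <= k <oo) (u k ^+ 2)%:E)%E.

Definition R_rhm sigma xi alpha theta (N : nat) : \bar R :=
  (\sum_(N.+1 <= k <oo) (theta k ^+ 2)%:E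
   + (\sum_(1 <= k < N.+1) sigma k ^+ 2)%:E
   + ((1 + alpha) * U0 sigma xi N)%:E)%E.

Definition rhm_risk sigma xi theta (Nrhm : (nat -> R) -> nat) : \bar R :=
  (\int[P]_w l2_sqnorm (fun k =>
     proj_estimator (observation sigma theta xi w)
       (Nrhm (observation sigma theta xi w)) k - theta k)%R)%E.

End sequence_space_model.

(* Main.v *)
From mathcomp Require Import ring lra zify measurable_realfun.
Require Import Defs.

Set Implicit Arguments.
Unset Strict Implicit.
Unset Printing Implicit Defensive.

Local Open Scope classical_set_scope.
Local Open Scope ring_scope.

(** The loss of the projection estimator at [N] is [D N + eta N], where [D N] is
the energy of [theta] beyond [N] plus [S N], the sum of the [sigma k ^+ 2] for
[k <= N], and [eta N] is the centred sum of the [sigma k ^+ 2 * xi k ^+ 2]. Up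
to the energy of [theta], which does not depend on [N], the criterion at [N] is
[D N - eta N - 2 * X N] plus the penalty, [X N] being the sum of the
[sigma k * theta k * xi k]. If [N] minimizes the criterion and [N0] is fixed,
the penalty at [N] being nonnegative,

  [D N <= R_rhm N0 - eta N0 + eta N + 2 * (X N - X N0)].

The mean of [eta N0] is zero, so everything rests on a bound of [eta N] and
[X N - X N0] at the random place [N], hence uniformly in [N]: with
[dl = gamma / 8], both must be smaller than [dl * (D N + D N0)] up to a remainder
of mean [O (sigma 1 ^+ 2 * dl `^ (- (4 * beta + 1)))]. The fraction of [D N] is
then moved to the left side ([oracle_pathwise]) and costs the factor
[1 + gamma].

Such bounds come from one principle: if every step of a walk with independent
steps has an exponential moment at most 1, the exponential of the walk is a
supermartingale, and the supremum of the walk over all times has an exponential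
tail ([reaches_tail]). Five walks are used: the sums of [xi k ^+ 2 - 1], with
both signs and a small drift; the sums of [theta k * xi k] after [N0], with both
signs; the sums of [- sigma k * theta k * xi k] from [N0] downwards, penalized by
a multiple of the energy of [theta] they cross. Almost surely, all of them stay
below one random number [g] with moments of all orders ([moment_envelope],
[walk_envelope]).

The weights are brought back by summation by parts ([abel_bound]), which is
possible because [sigma] is nondecreasing: [eta N] is at most
[2 * sigma N ^+ 2] times the largest of the first [N] partial sums of
[xi k ^+ 2 - 1], that is, at most a multiple of
[sigma N ^+ 2 * (dl * N + g / dl)]. The polynomial hypothesis now yields two
deterministic facts. First, [N * sigma N ^+ 2] is at most a multiple of [S N]
([index_sqr_le_noise_level]). Second, [a * sigma N ^+ 2 / dl] is at most
[dl * S N] plus a multiple of [sigma 1 ^+ 2 * a ^+ m * dl `^ (- (4 * beta + 1))]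
([young_noise_level]), which is where the exponent [4 * beta + 1] is born. For
[X N - X N0] the second fact is enough.

The same bounds show that the criterion tends to infinity almost surely
([criterion_attained]), so that a minimizer exists. *)

(** * Gaussian expectations *)

Section gaussian.
Context {R : realType}.
Local Notation mu := (@lebesgue_measure R).
Local Open Scope ereal_scope.

Import HBNNSimple.

(** By monotone convergence it is enough to integrate simple functions, for which
the equality is the definition of the measure. *)
Lemma ge0_integral_normal_prob (m s : R) (f : measurableTypeR R -> \bar R) :
  measurable_fun setT f -> (forall x, 0 <= f x) ->
  \int[normal_prob m s]_x f x = \int[mu]_x (f x * (normal_pdf m s x)%:E).
Proof.
move=> mf f0.
have mpdf := measurable_normal_pdf m s.
pose g := nnsfun_approx measurableT mf.
have pdf0 x : 0 <= (normal_pdf m s x)%:E by rewrite lee_fin normal_pdf_ge0.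
transitivity (limn (fun n => \int[normal_prob m s]_x (g n x)%:E)).
  rewrite -monotone_convergence//=.
  - apply: eq_integral => x _; apply/esym/cvg_lim => //=.
    exact: cvg_nnsfun_approx.
  - by move=> n; exact/measurable_EFinP/measurable_funTS.
  - by move=> n x _; rewrite lee_fin.
  - by move=> x _ a b ab; rewrite lee_fin; exact/lefP/nd_nnsfun_approx.
transitivity (limn (fun n => \int[mu]_x ((g n x)%:E * (normal_pdf m s x)%:E)));
    last first.
  rewrite -monotone_convergence//=.
  - apply: eq_integral => x _; apply/cvg_lim => //=.
    by apply: cvgeMr => //; exact: cvg_nnsfun_approx.
  - move=> n; apply: emeasurable_funM; last exact/measurable_EFinP.
    exact/measurable_EFinP/measurable_funTS.
  - by move=> n x _; rewrite mule_ge0// lee_fin.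
  - move=> x _ a b ab; rewrite lee_wpmul2r// lee_fin; exact/lefP/nd_nnsfun_approx.
apply: congr_lim; apply/funext => n /=.
under [LHS]eq_integral do rewrite fimfunE -fsumEFin//.
rewrite [LHS]ge0_integral_fsum//; last 2 first.
  - by move=> r; exact/measurable_EFinP/measurableT_comp.
  - by move=> k x _; rewrite EFinM nnfun_muleindic_ge0.
under [RHS]eq_integral.
  move=> x xD; rewrite muleC fimfunE -fsumEFin// ge0_mule_fsumr; last first.
    by move=> r; rewrite EFinM nnfun_muleindic_ge0.
  over.
rewrite [RHS]ge0_integral_fsum//; last 2 first.
  - move=> r; apply: emeasurable_funM; apply/measurable_EFinP => //.
    exact: measurableT_comp.
  - by move=> k x _; rewrite EFinM mule_ge0// nnfun_muleindic_ge0.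
apply: eq_fsbigr => r _.
under [RHS]eq_integral do rewrite EFinM muleCA.
have mE : measurable (g n @^-1` [set r]) by exact: measurable_sfunP.
rewrite integralZl_indic_nnsfun//= integral_indic//= setIT /normal_prob.
have [r0|r0] := ltP r 0%R.
  rewrite preimage_nnfun0// integral_set0 mule0.
  by apply/esym/integral0_eq => x _; rewrite indic0 !mule0.
rewrite ge0_integralZl//.
- congr (_ * _); rewrite [LHS]integral_mkcond; apply: eq_integral => x _.
  by rewrite patchE indicE; case: ifP => _; rewrite ?mule1 ?mule0.
- by apply: emeasurable_funM; exact/measurable_EFinP.
- by move=> x _; rewrite mule_ge0// lee_fin.
Qed.

Lemma ge0_expectation_normal d (T : measurableType d) (P : probability T R)
    (X : {RV P >-> R}) (f : R -> \bar R) :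
  (forall B : set R, measurable B -> distribution P X B = normal_prob 0 1 B) ->
  measurable_fun setT f -> (forall x, 0 <= f x) ->
  \int[P]_w f (X w) = \int[mu]_x (f x * (normal_pdf 0 1 x)%:E).
Proof.
move=> XN mf f0; rewrite -ge0_integral_normal_prob//.
(* [normal_prob] lives on [measurableTypeR R], whose structure of measurable
   space has the same sets as that of [R] but is another term. *)
have mX : measurable_fun setT (X : T -> measurableTypeR R).
  exact: (@measurable_funPT _ _ _ _ X).
pose Y : {mfun T >-> measurableTypeR R} :=
  @mfun_Sub _ _ T (measurableTypeR R) X (mem_set mX).
transitivity (\int[distribution P Y]_x f x).
  by rewrite ge0_integral_distribution.
apply: eq_measure_integral => B mB _; exact: XN.
Qed.

(** Completing the square turns the tilted density into a multiple of the density
centred at [a]. *)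
Lemma integral_expR_normal_pdf (a : R) :
  \int[mu]_x ((expR (a * x))%:E * (normal_pdf 0 1 x)%:E) = (expR (a ^+ 2 / 2))%:E.
Proof.
have tilt x : (expR (a * x) * normal_pdf 0 1 x =
               expR (a ^+ 2 / 2) * normal_pdf a 1 x)%R.
  rewrite !normal_pdfE ?oner_eq0// mulrCA [RHS]mulrCA; congr (_ * _)%R.
  by rewrite /normal_fun -!expRD; congr expR; rewrite subr0 expr1n; field.
under eq_integral do rewrite -EFinM tilt EFinM.
rewrite ge0_integralZl//= ?integral_normal_pdf ?mule1//.
- by apply: measurableT_comp => //; exact: measurable_normal_pdf.
- by move=> x _; rewrite lee_fin normal_pdf_ge0.
Qed.

(** A quadratic tilt only changes the standard deviation of the density, into
[(Num.sqrt (1 - 2 * l))^-1]. *)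
Lemma integral_expR_sqr_normal_pdf (l : R) : (l < 2^-1)%R ->
  \int[mu]_x ((expR (l * x ^+ 2))%:E * (normal_pdf 0 1 x)%:E) =
  ((Num.sqrt (1 - 2 * l))^-1)%:E.
Proof.
move=> l2; have c0 : (0 < 1 - 2 * l)%R by lra.
pose s : R := ((Num.sqrt (1 - 2 * l))^-1)%R.
have s0 : (0 < s)%R by rewrite invr_gt0 sqrtr_gt0.
have s2 : (s ^+ 2 = (1 - 2 * l)^-1)%R by rewrite exprVn sqr_sqrtr// ltW.
have tilt x : (expR (l * x ^+ 2) * normal_pdf 0 1 x = s * normal_pdf 0 s x)%R.
  rewrite !normal_pdfE ?oner_eq0 ?gt_eqF// mulrCA [RHS]mulrA; congr (_ * _)%R.
    rewrite /normal_peak s2 expr1n -!mulrnAr.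
    rewrite [in RHS]sqrtrM ?invr_ge0 1?ltW// sqrtrV 1?ltW//.
    by rewrite invfM invrK mulrA /s mulVf ?mul1r// gt_eqF// sqrtr_gt0.
  rewrite /normal_fun -!expRD; congr expR; rewrite subr0 expr1n s2; field.
  lra.
under eq_integral do rewrite -EFinM tilt EFinM.
rewrite ge0_integralZl//= ?integral_normal_pdf ?mule1//.
- by apply: measurableT_comp => //; exact: measurable_normal_pdf.
- by move=> x _; rewrite lee_fin normal_pdf_ge0.
- by rewrite lee_fin ltW.
Qed.

Local Close Scope ereal_scope.

(** A second order lower bound of [ln (1 - u)], in exponential form. *)
Lemma expR_sqr_le1B (u : R) : u <= 2^-1 -> expR (- (u + 2 * u ^+ 2)) <= 1 - u.
Proof.
move=> u2; rewrite expRN -lef_pV2 ?posrE ?invr_gt0 ?expR_gt0//; last by lra.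
rewrite invrK; apply: le_trans (expR_ge1Dx _).
rewrite -[_^-1]mul1r ler_pdivrMr; last by lra.
suff : 0 <= u ^+ 2 * (1 - 2 * u) by nra.
by rewrite mulr_ge0 ?sqr_ge0//; lra.
Qed.

Section moments.
Context d (T : measurableType d) (P : probability T R) (X : {RV P >-> R}).
Hypothesis XN : forall B : set R, measurable B ->
  distribution P X B = normal_prob 0 1 B.

Lemma normal_mgf (a : R) :
  (\int[P]_w (expR (a * X w))%:E = (expR (a ^+ 2 / 2))%:E)%E.
Proof.
rewrite -integral_expR_normal_pdf.
rewrite (@ge0_expectation_normal _ _ _ _ (fun x => (expR (a * x))%:E) XN)//.
apply/measurable_EFinP; apply: measurableT_comp => //.
Qed.

Lemma normal_sqr_mgf (l : R) : l <= 4^-1 ->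
  (\int[P]_w (expR (l * (X w ^+ 2 - 1)))%:E <= (expR (4 * l ^+ 2))%:E)%E.
Proof.
move=> l4.
rewrite (@ge0_expectation_normal _ _ _ _
  (fun x => (expR (l * (x ^+ 2 - 1)))%:E) XN)//; last first.
  apply/measurable_EFinP; apply: measurableT_comp => //.
  by apply: measurable_funM => //; exact: measurable_funB.
have E x : ((expR (l * (x ^+ 2 - 1)))%:E * (normal_pdf 0 1 x)%:E =
    (expR (- l))%:E * ((expR (l * x ^+ 2))%:E * (normal_pdf 0 1 x)%:E))%E.
  by rewrite muleA; congr (_ * _)%E; rewrite -EFinM -expRD; congr (expR _)%:E; ring.
under eq_integral do rewrite E.
rewrite ge0_integralZl//=; last 2 first.
- apply: emeasurable_funM; apply/measurable_EFinP.
    by apply: measurableT_comp => //; exact: measurable_funM.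
  exact: measurable_normal_pdf.
- by move=> x _; rewrite mule_ge0// lee_fin ?expR_ge0 ?normal_pdf_ge0.
rewrite integral_expR_sqr_normal_pdf -?EFinM ?lee_fin; last by lra.
have c0 : 0 < 1 - 2 * l by lra.
rewrite ler_pdivrMr ?sqrtr_gt0//.
have -> : - l = 4 * l ^+ 2 - (l + 4 * l ^+ 2) by ring.
rewrite expRD ler_pM2l ?expR_gt0//.
rewrite -(@ler_pXn2r _ 2%N) ?nnegrE ?expR_ge0 ?sqrtr_ge0// sqr_sqrtr; last exact: ltW.
rewrite -expRM_natl; apply: le_trans (expR_sqr_le1B _); last by lra.
by rewrite ler_expR le_eqVlt; apply/orP; left; apply/eqP; ring.
Qed.

(** For small [l > 0], [1 - l * (X ^+ 2 - 1) <= expR (- l * (X ^+ 2 - 1))], and the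
mean of the right side is [1 + O (l ^+ 2)]: comparing the terms of order [l]
bounds the mean of [X ^+ 2] from below. *)
Lemma normal_sqr_ge1 : (1 <= \int[P]_w (X w ^+ 2)%:E)%E.
Proof.
have mX2 : measurable_fun setT (fun w => (X w ^+ 2)%:E).
  by apply/measurable_EFinP/measurable_funX.
have m0 : (0 <= \int[P]_w (X w ^+ 2)%:E)%E.
  by apply: integral_ge0 => w _; rewrite lee_fin sqr_ge0.
case E : (\int[P]_w (X w ^+ 2)%:E)%E m0 => [m| |//]; last by move=> _; exact: leey.
rewrite !lee_fin => m0.
suff H l : 0 < l -> l <= 4^-1 -> 1 <= 8 * l + m.
  rewrite leNgt; apply/negP => m1.
  have : 1 <= 8 * ((1 - m) / 16) + m by apply: H; lra.
  lra.
move=> l0 l4.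
have lE : ((1 + l)%:E <= (expR (4 * l ^+ 2))%:E + l%:E * m%:E)%E.
  apply: (@le_trans _ _ (\int[P]_w (expR (- l * (X w ^+ 2 - 1)) + l * X w ^+ 2)%:E)%E).
    rewrite -[leLHS]mule1 -(@probability_setT _ _ _ P) -integral_cst//.
    apply: ge0_le_integral => //.
    - by move=> w _; rewrite lee_fin; lra.
    - apply/measurable_EFinP; apply: measurable_funD.
        apply: measurableT_comp => //; apply: measurable_funM => //.
        by apply: measurable_funB => //; exact: measurable_funX.
      by apply: measurable_funM => //; exact: measurable_funX.
    - move=> w _; rewrite lee_fin.
      by have := expR_ge1Dx (- l * (X w ^+ 2 - 1)); lra.
  under eq_integral do rewrite EFinD EFinM.
  rewrite ge0_integralD//; last 3 first.
  - apply/measurable_EFinP.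
    apply: measurableT_comp => //; apply: measurable_funM => //.
    by apply: measurable_funB => //; exact: measurable_funX.
  - by move=> w _; rewrite mule_ge0// lee_fin ?sqr_ge0// ltW.
  - exact: emeasurable_funM.
  rewrite ge0_integralZl//; last 2 first.
  - by move=> w _; rewrite lee_fin sqr_ge0.
  - by rewrite lee_fin ltW.
  rewrite E leeD2r//.
  by apply: le_trans (normal_sqr_mgf _) _; rewrite ?lee_fin ?sqrrN//; lra.
move: lE; rewrite -EFinM -EFinD lee_fin => lE.
have l2 : l ^+ 2 <= 16^-1 by rewrite expr2; nra.
have e2 : expR (4 * l ^+ 2) <= 1 + 8 * l ^+ 2.
  have e1 : expR (4 * l ^+ 2) * (1 - 4 * l ^+ 2) <= 1.
    rewrite -[leRHS](expRxMexpNx_1 (4 * l ^+ 2)) ler_pM2l ?expR_gt0//.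
    exact: expR_ge1Dx.
  rewrite -(@ler_pM2r _ (1 - 4 * l ^+ 2)); last by lra.
  by apply: le_trans e1 _; nra.
have : l * 1 <= l * (8 * l + m) by nra.
by rewrite ler_pM2l.
Qed.

End moments.
End gaussian.

(** * Independence along a driven sequence *)

(** Measurable rectangles form a pi-system that generates the product
sigma-algebra. *)
Lemma eq_finite_measure_rectangle d1 d2 (T1 : measurableType d1)
    (T2 : measurableType d2) (R : realType)
    (m1 m2 : {measure set (T1 * T2) -> \bar R}) :
  (m1 setT < +oo)%E ->
  (forall A B, measurable A -> measurable B -> m1 (A `*` B) = m2 (A `*` B)) ->
  forall C, measurable C -> m1 C = m2 C.
Proof.
move=> m1T m12 C mC.
pose G : set (set (T1 * T2)) :=
  [set C | exists A, measurable A /\ exists B, measurable B /\ C = A `*` B].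
have GI : setI_closed G.
  move=> /= _ _ [X1 [mX1 [X2 [mX2 ->]]]] [Y1 [mY1 [Y2 [mY2 ->]]]].
  rewrite -setXI; exists (X1 `&` Y1); split; first exact: measurableI.
  by exists (X2 `&` Y2); split => //; exact: measurableI.
apply: (measure_unique G (fun=> setT)) => //.
- rewrite measurable_prod_measurableType //; congr (<<s _ >>).
  rewrite predeqE => E; split => [[A mA [B mB <-]]|[A [mA [B [mB ->]]]]].
    by exists A; split => //; exists B.
  by exists A => //; exists B.
- by move=> _; exists setT; split => //; exists setT; split => //; rewrite setXTT.
- by apply/seteqP; split => // x _; exists 0%N.
- by move=> A [A1 [mA1 [A2 [mA2 ->]]]]; exact: m12.
Qed.

(** Both sides are finite measures as functions of [C], so that equality on
rectangles is enough. *)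
Lemma pair_indep_event d (T : measurableType d) (R : realType)
    (P : probability T R) (X Y : T -> R) (E : set T) :
  measurable_fun setT X -> measurable_fun setT Y -> measurable E ->
  (forall A B, measurable A -> measurable B ->
    P ((X @^-1` A `&` Y @^-1` B) `&` E) =
    P (X @^-1` A `&` Y @^-1` B) * P E)%E ->
  forall C, measurable C ->
    (P ((fun w => (X w, Y w)) @^-1` C `&` E) =
     P ((fun w => (X w, Y w)) @^-1` C) * P E)%E.
Proof.
move=> mX mY mE XYE C mC.
have mphi : measurable_fun setT (fun w => (X w, Y w)).
  exact: measurable_fun_pair.
pose phi w := (X w, Y w).
have PE : P E = (fine (P E))%:E by rewrite fineK// fin_num_measure.
pose r : {nonneg R} := NngNum (fine_ge0 (measure_ge0 P E)).
pose m1 : {measure set (R * R)%type -> \bar R} := pushforward (mrestr P mE) phi.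
pose m2 : {measure set (R * R)%type -> \bar R} := mscale r (pushforward P phi).
rewrite muleC PE.
apply: (@eq_finite_measure_rectangle _ _ _ _ _ (m1 mphi) (m2 mphi)) mC.
  by rewrite /m1 /= /pushforward /mrestr preimage_setT setTI PE ltry.
move=> A B mA mB; rewrite /m1 /m2 /= /pushforward /mrestr /mscale /=.
by rewrite -PE muleC; exact: XYE.
Qed.

Section independent_driving_sequence.
Context d (T : measurableType d) (R : realType) (P : probability T R).
Variable xi : nat -> {RV P >-> R}.
Hypothesis xi_indep : mutually_independent [set k | (1 <= k)%N] xi.
Variable iota : nat -> nat.
Hypothesis iota_inj : injective iota.
Hypothesis iota_gt0 : forall j, (1 <= iota j)%N.

Variable x0 : R.
Variable step : nat -> R * R -> R.
Hypothesis mstep : forall n, measurable_fun setT (step n).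

(** A state updated at time [n] with the variable of index [iota n]. Both a walk
and a walk stopped at a random time are of this form. *)
Fixpoint driven n (w : T) : R :=
  if n is n'.+1 then step n' (driven n' w, xi (iota n') w) else x0.

Lemma measurable_driven n : measurable_fun setT (driven n).
Proof.
elim: n => [|n IH] /=; first exact: measurable_cst.
apply: (measurableT_comp (mstep n)); exact: measurable_fun_pair.
Qed.

Let event (J : {fset nat}) (B : nat -> set R) : set T :=
  \bigcap_(i in [set` J]) xi i @^-1` B i.

Let measurable_event J B : (forall i, i \in J -> measurable (B i)) ->
  measurable (event J B).
Proof.
move=> mB; apply: fin_bigcap_measurable => // i /= iJ.
rewrite -[_ @^-1` _]setTI; exact: (measurable_funPT (xi i)) (mB _ iJ).
Qed.

(** The state at time [n.+1] is a function of the pair made of the previous state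
and a fresh variable, and the independence of this pair from an event extends
from rectangles to all measurable sets ([pair_indep_event]). The induction runs
over all finite families [J] of unused indices, because a rectangle for the pair
adds one index to the family. *)
Lemma driven_indep n (J : {fset nat}) (B : nat -> set R) (A : set R) :
  (forall i, i \in J -> (1 <= i)%N) ->
  (forall i j, i \in J -> (j < n)%N -> i != iota j) ->
  (forall i, i \in J -> measurable (B i)) -> measurable A ->
  (P (driven n @^-1` A `&` event J B) = P (driven n @^-1` A) * P (event J B))%E.
Proof.
elim: n J B A => [|n IH] J B A J1 Jn mB mA.
  have [Ax|Ax] := pselect (A x0).
    rewrite (_ : driven 0 @^-1` A = setT) ?setTI ?probability_setT ?mul1e//.
    by apply/seteqP; split.
  rewrite (_ : driven 0 @^-1` A = set0) ?set0I ?measure0 ?mul0e//.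
  by apply/seteqP; split.
have mE : measurable (event J B) by exact: measurable_event.
have kJ : iota n \notin J by apply/negP => /Jn/(_ (ltnSn n)); rewrite eqxx.
pose B' C i := if i == iota n then C else B i.
have B'J C i : i \in J -> B' C i = B i.
  by rewrite /B'; case: eqP => // ->; rewrite (negbTE kJ).
have evU C : event (iota n |` J)%fset (B' C) = xi (iota n) @^-1` C `&` event J B.
  apply/seteqP; split=> [w H|w [wC H] i /=].
    split.
      by have := H (iota n); rewrite /= /B' eqxx; apply; rewrite fset1U1.
    by move=> i /= iJ; rewrite -(B'J C)//; apply: H => /=; rewrite fset1Ur.
  rewrite !inE => /orP[/eqP->|iJ]; first by rewrite /B' eqxx.
  by rewrite B'J//; exact: H.
have ev1 C : event [fset iota n]%fset (fun=> C) = xi (iota n) @^-1` C.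
  apply/seteqP; split=> [w|w wC i /=]; first by apply; rewrite /= inE.
  by rewrite inE => /eqP ->.
have indep (F : {fset nat}) (D : nat -> set R) :
    (forall i, i \in F -> (1 <= i)%N) -> (forall i, i \in F -> measurable (D i)) ->
    P (event F D) = (\prod_(i <- F) P (xi i @^-1` D i))%E.
  by move=> F1 mD; apply: xi_indep => // i /= /F1.
have mB' C : measurable C -> forall i, i \in (iota n |` J)%fset -> measurable (B' C i).
  move=> mC i; rewrite !inE => /orP[/eqP->|iJ]; first by rewrite /B' eqxx.
  by rewrite B'J//; exact: mB.
have kU1 i : i \in (iota n |` J)%fset -> (1 <= i)%N.
  by rewrite !inE => /orP[/eqP->//|]; exact: J1.
have xiE C : measurable C ->
    P (xi (iota n) @^-1` C `&` event J B) =
    (P (xi (iota n) @^-1` C) * P (event J B))%E.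
  move=> mC; rewrite -evU indep//; last exact: mB'.
  rewrite big_fsetU1//= /B' eqxx; congr (_ * _)%E; rewrite indep//.
  apply: eq_big_seq => i iJ; congr (P (_ @^-1` _)).
  by move: (B'J C i iJ); rewrite /B'.
have rect (C D : set R) : measurable C -> measurable D ->
   (P ((driven n @^-1` C `&` xi (iota n) @^-1` D) `&` event J B) =
    P (driven n @^-1` C `&` xi (iota n) @^-1` D) * P (event J B))%E.
  move=> mC mD; rewrite -setIA -evU IH//; last first.
  - exact: mB'.
  - move=> i j; rewrite !inE => /orP[/eqP-> jn|iJ jn].
      by rewrite (inj_eq iota_inj) gtn_eqF.
    by apply: Jn => //; exact: ltnW.
  rewrite evU xiE// -(ev1 D) [X in (_ = X * _)%E]IH ?ev1 ?muleA//.
  - by move=> i; rewrite inE => /eqP->.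
  - by move=> i j; rewrite inE => /eqP-> jn; rewrite (inj_eq iota_inj) gtn_eqF.
have mC : measurable (step n @^-1` A) by rewrite -[_ @^-1` _]setTI; exact: mstep.
exact: (pair_indep_event (measurable_driven n)
  (measurable_funPT (xi (iota n))) mE rect mC).
Qed.

End independent_driving_sequence.

(** The law of the pair is the product of the laws; Tonelli does the rest. *)
Lemma ge0_expectationM_indep d (T : measurableType d) (R : realType)
    (P : probability T R) (X Y : T -> R) (F H : R -> \bar R) :
  measurable_fun setT X -> measurable_fun setT Y ->
  (forall A B, measurable A -> measurable B ->
    P (X @^-1` A `&` Y @^-1` B) = P (X @^-1` A) * P (Y @^-1` B))%E ->
  measurable_fun setT F -> measurable_fun setT H ->
  (forall x, 0 <= F x)%E -> (forall x, 0 <= H x)%E ->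
  (\int[P]_w (F (X w) * H (Y w)) = \int[P]_w F (X w) * \int[P]_w H (Y w))%E.
Proof.
move=> mX mY XY mF mH F0 H0.
pose X' : {RV P >-> R} := mfun_Sub (mem_set mX).
pose Y' : {RV P >-> R} := mfun_Sub (mem_set mY).
have mphi : measurable_fun setT (fun w => (X w, Y w)).
  exact: measurable_fun_pair.
pose phi w := (X w, Y w).
pose f (z : R * R) := (F z.1 * H z.2)%E.
have f0 z : (0 <= f z)%E by rewrite mule_ge0.
have mf : measurable_fun setT f.
  by apply: emeasurable_funM; exact: measurableT_comp.
pose m1 : {measure set (R * R)%type -> \bar R} := pushforward P phi.
pose m2 : {measure set (R * R)%type -> \bar R} :=
  (distribution P X' \x distribution P Y')%E.
transitivity (\int[m1 mphi]_z f z)%E.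
  by rewrite ge0_integral_pushforward.
transitivity (\int[m2]_z f z)%E.
  apply: eq_measure_integral => C mC _.
  apply: (@eq_finite_measure_rectangle _ _ _ _ _ (m1 mphi) m2) mC.
    by rewrite /m1 /= /pushforward preimage_setT probability_setT ltry.
  move=> A B mA mB.
  by rewrite /m1 /m2 /= product_measure1E// -XY.
rewrite /m2 fubini_tonelli1//= /fubini_F /f/=.
under eq_integral => x _.
  rewrite ge0_integralZl//; first over.
rewrite ge0_integralZr//; last by apply: integral_ge0.
rewrite (@ge0_integral_distribution _ _ _ _ _ P X')//.
by rewrite (@ge0_integral_distribution _ _ _ _ _ P Y').
Qed.

(** * An exponential maximal inequality *)

Section exponential_maximal_inequality.
Context d (T : measurableType d) (R : realType) (P : probability T R).
Variable xi : nat -> {RV P >-> R}.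
Hypothesis xi_indep : mutually_independent [set k | (1 <= k)%N] xi.
Variable iota : nat -> nat.
Hypothesis iota_inj : injective iota.
Hypothesis iota_gt0 : forall j, (1 <= iota j)%N.
Variable f : nat -> R -> R.
Hypothesis mf : forall j, measurable_fun setT (f j).
Hypothesis f_mgf : forall j,
  (\int[P]_w (expR (f j (xi (iota j) w)))%:E <= 1)%E.

Definition walk n (w : T) : R := \sum_(0 <= j < n) f j (xi (iota j) w).

Lemma measurable_walk n : measurable_fun setT (walk n).
Proof.
apply: measurable_sum => j.
by apply: (measurableT_comp (mf j)).
Qed.

Section stopped.
Variable c : R.

(** The exponential of the walk, frozen as soon as it reaches the level [c]. *)
Let step n (z : R * R) : R := if c <= z.1 then z.1 else z.1 * expR (f n z.2).

Let mstep n : measurable_fun setT (step n).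
Proof.
apply: measurable_fun_if => //.
- exact: measurable_fun_ler.
- exact: measurable_funTS.
- apply: measurable_funTS; apply: measurable_funM => //.
  by apply: measurableT_comp => //; exact: measurableT_comp.
Qed.

Definition stopped := driven xi iota 1 step.

Lemma measurable_stopped n : measurable_fun setT (stopped n).
Proof. exact: measurable_driven. Qed.
Let mstopped := measurable_stopped.

Lemma stopped_ge0 n w : 0 <= stopped n w.
Proof.
elim: n => [|n IH] //=; rewrite /step /=; case: ifP => // _.
by rewrite mulr_ge0// expR_ge0.
Qed.

Lemma stoppedP n w : c <= stopped n w \/
  stopped n w = expR (walk n w) /\ forall m, (m <= n)%N -> expR (walk m w) < c.
Proof.
elim: n => [|n [IH|[IH IHm]]] /=.
- have [c1|c1] := leP c 1; [by left|right].
  rewrite /walk big_geq// expR0; split=> // m; rewrite leqn0 => /eqP->.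
  by rewrite big_geq// expR0.
- by left; rewrite /step /= IH.
- have -> : step n (stopped n w, xi (iota n) w) = expR (walk n.+1 w).
    by rewrite /step /= IH leNgt IHm//= -expRD /walk big_nat_recr.
  have [cn|cn] := leP c (expR (walk n.+1 w)); [by left|right; split=> // m].
  by rewrite leq_eqVlt => /orP[/eqP->//|]; exact: IHm.
Qed.

(** A frozen state does not move, and a state below [c] is multiplied by an
independent factor of mean at most 1. *)
Lemma expectation_stopped n : (\int[P]_w (stopped n w)%:E <= 1)%E.
Proof.
elim: n => [|n IH] /=; first by rewrite integral_cst//= mul1e probability_le1.
pose F (x : R) := (if c <= x then 0 else `|x|)%:E.
pose G (x : R) := (if c <= x then `|x| else 0)%:E.
have mF : measurable_fun setT F.
  apply/measurable_EFinP; apply: measurable_fun_if => //.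
    exact: measurable_fun_ler.
have mG : measurable_fun setT G.
  apply/measurable_EFinP; apply: measurable_fun_if => //.
    exact: measurable_fun_ler.
have F0 x : (0 <= F x)%E by rewrite /F lee_fin; case: ifP.
have G0 x : (0 <= G x)%E by rewrite /G lee_fin; case: ifP.
have mFs : measurable_fun setT (fun w => F (stopped n w)) by exact: measurableT_comp.
have mGs : measurable_fun setT (fun w => G (stopped n w)) by exact: measurableT_comp.
pose H (x : R) := (expR (f n x))%:E.
have mH : measurable_fun setT H.
  by apply/measurable_EFinP; exact: measurableT_comp.
have H0 x : (0 <= H x)%E by rewrite lee_fin expR_ge0.
have mHx : measurable_fun setT (fun w => H (xi (iota n) w)) by exact: measurableT_comp.
have E w : ((step n (stopped n w, xi (iota n) w))%:E =
    G (stopped n w) + F (stopped n w) * H (xi (iota n) w))%E.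
  rewrite /step /G /F /H /= ger0_norm ?stopped_ge0//.
  by case: ifP => _; rewrite ?mul0e ?adde0 ?add0e.
under eq_integral do rewrite E.
rewrite ge0_integralD//; last 2 first.
- by move=> w _; rewrite mule_ge0.
- exact: emeasurable_funM.
rewrite ge0_expectationM_indep//; last first.
  move=> A B mA mB.
  have := @driven_indep _ _ _ _ _ xi_indep _ iota_inj iota_gt0 1 _ mstep n
    [fset (iota n)]%fset (fun=> B) A.
  have -> : \bigcap_(i in [set` [fset (iota n)]%fset]) xi i @^-1` B =
      xi (iota n) @^-1` B.
    apply/seteqP; split=> [w|w wC i /=]; first by apply; rewrite /= inE.
    by rewrite inE => /eqP ->.
  apply=> //.
  - by move=> i; rewrite inE => /eqP->.
  - by move=> i j; rewrite inE => /eqP-> jn; rewrite (inj_eq iota_inj) gtn_eqF.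
apply: le_trans IH.
apply: (@le_trans _ _ (\int[P]_w G (stopped n w) + \int[P]_w F (stopped n w))%E).
  rewrite leeD2l// -[leRHS]mule1; apply: lee_wpmul2l; last exact: f_mgf.
  by apply: integral_ge0 => w _.
rewrite le_eqVlt; apply/orP; left; apply/eqP.
transitivity (\int[P]_w (G (stopped n w) + F (stopped n w)))%E.
  by rewrite ge0_integralD.
apply: eq_integral => w _; rewrite /G /F ger0_norm ?stopped_ge0//.
by case: ifP => _; rewrite ?adde0 ?add0e.
Qed.

Lemma stopped_tail n : 0 < c -> (P [set w | (c <= stopped n w)%R] <= (c^-1)%:E)%E.
Proof.
move=> c0.
have mA : measurable [set w | c <= stopped n w].
  rewrite -[X in measurable X]setTI.
  exact: (measurable_fun_ler (measurable_cst c) (mstopped n)).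
set A := [set w | _] in mA *.
have PA : P A = (fine (P A))%:E by rewrite fineK// fin_num_measure.
suff : (c%:E * P A <= 1)%E.
  by rewrite PA -EFinM !lee_fin -[c^-1]mul1r ler_pdivlMr// mulrC.
apply: le_trans (expectation_stopped n).
rewrite -integral_cst//.
apply: (@le_trans _ _ (\int[P]_(w in A) (stopped n w)%:E)%E).
  apply: ge0_le_integral => //.
  - by move=> w _; rewrite lee_fin ltW.
  - exact/measurable_EFinP/measurable_funTS.
apply: ge0_subset_integral => //.
- exact/measurable_EFinP.
- by move=> w _; rewrite lee_fin stopped_ge0.
Qed.
End stopped.

Definition reaches (x : R) : set T := [set w | exists n, x <= walk n w].

Lemma measurable_reaches x : measurable (reaches x).
Proof.
rewrite (_ : reaches x = \bigcup_n [set w | x <= walk n w]).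
  apply: bigcupT_measurable => n; rewrite -[X in measurable X]setTI.
  exact: (measurable_fun_ler (measurable_cst x) (measurable_walk n)).
by apply/seteqP; split=> w [n]; [exists n|exists n].
Qed.

(** Freezing makes the event that the walk reaches [x] by time [n] visible at time
[n], so that Markov's inequality bounds its probability independently of
[n]. *)
Lemma reaches_tail x : (P (reaches x) <= (expR (- x))%:E)%E.
Proof.
pose A n := [set w | expR x <= stopped (expR x) n w].
have mA n : measurable (A n).
  rewrite -[X in measurable X]setTI.
  exact: (measurable_fun_ler (measurable_cst _) (measurable_stopped _ n)).
have ndA : nondecreasing_seq A.
  apply/nondecreasing_seqP => n; apply/subsetPset => w /= cw.
  by rewrite /A /= cw.
have mUA : measurable (\bigcup_n A n) by exact: bigcupT_measurable.
apply: (@le_trans _ _ (P (\bigcup_n A n))).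
  apply: le_measure; rewrite ?inE//; first exact: measurable_reaches.
  move=> w [n xn]; exists n => //=.
  have [//|[_ /(_ n (leqnn n))]] := stoppedP (expR x) n w.
  by rewrite ltr_expR ltNge xn.
have PA := nondecreasing_cvg_mu mA mUA ndA (mu := P).
rewrite -(cvg_lim _ PA)//; apply: lime_le; first by apply/cvg_ex; eexists; exact: PA.
by apply: nearW => n; rewrite expRN; apply: stopped_tail; exact: expR_gt0.
Qed.

End exponential_maximal_inequality.

(** * Moment envelopes *)

(** The value of the geometric series that bounds the one in
[nneseries_exprn_expR]. *)
Definition envelope_mean (R : realType) (m : nat) : R :=
  2 ^+ m * m`!%:R * expR 1 / (1 - expR (- 2^-1)).

Lemma expR_half_lt1 (R : realType) : expR (- 2^-1) < 1 :> R.
Proof. by rewrite -[ltRHS]expR0 ltr_expR; lra. Qed.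

Lemma envelope_mean_ge0 (R : realType) m : 0 <= envelope_mean R m.
Proof.
by rewrite mulr_ge0// ?invr_ge0 ?subr_ge0 ?(ltW (expR_half_lt1 R))// mulr_ge0 ?expR_ge0.
Qed.

(** The power [n.+2%:R ^+ m] is at most [2 ^+ m * m`!%:R * expR (n / 2 + 1)], which
leaves a geometric series of ratio [expR (- 2^-1)]. *)
Lemma nneseries_exprn_expR (R : realType) (m : nat) :
  (\sum_(0 <= n <oo) (n.+2%:R ^+ m * expR (- n%:R))%:E <= (envelope_mean R m)%:E)%E.
Proof.
have term n : n.+2%:R ^+ m * expR (- n%:R) <=
    2 ^+ m * m`!%:R * expR 1 * expR (- 2^-1) ^+ n :> R.
  have mfact_gt0 : 0 < m`!%:R :> R by rewrite ltr0n fact_gt0.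
  pose x : R := n.+2%:R / 2.
  have xm : x ^+ m <= m`!%:R * expR x.
    rewrite -ler_pdivrMl// mulrC.
    case: (m) => [|k]; first by rewrite expr0 fact0 divr1 -expR0 ler_expR divr_ge0.
    have x0 : 0 <= x by rewrite divr_ge0.
    by apply: le_trans (expR_ge1Dxn k x0); rewrite lerDr ler01.
  have -> : n.+2%:R = 2 * x by rewrite /x; field.
  rewrite exprMn -!mulrA ler_pM2l ?exprn_gt0//.
  rewrite -expRM_natl -expRD mulrC.
  have -> : 1 + n%:R * - 2^-1 = - n%:R + x by rewrite /x -(addn2 n) natrD; field.
  by rewrite expRD mulrCA ler_pM2l ?expR_gt0.
apply: lime_le.
  by apply: is_cvg_nneseries => n _ _; rewrite lee_fin mulr_ge0 ?exprn_ge0 ?expR_ge0.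
apply: nearW => n; rewrite sumEFin lee_fin.
apply: (le_trans (ler_sum _ (fun i _ => term i))).
have C0 : 0 <= 2 ^+ m * m`!%:R * expR 1 :> R by rewrite mulr_ge0 ?expR_ge0.
have := @geometric_le_lim R n _ _ C0 (expR_gt0 (- 2^-1)).
by rewrite ger0_norm ?expR_ge0//; apply; exact: expR_half_lt1.
Qed.

(** A family of random functions is controlled through a single integrable
random variable that dominates a power of all its members at once; suprema of
the family, possibly infinite, then need not be handled. *)
Definition moment_envelope d (T : measurableType d) (R : realType)
    (P : probability T R) (F : set (T -> R)) (p : nat) (c : R) : Prop :=
  exists H : T -> \bar R,
  [/\ measurable_fun setT H, forall w, (0 <= H w)%E,
      forall f, F f -> forall w, (((1 + Num.max 0 (f w)) ^+ p)%:E <= H w)%E &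
      (\int[P]_w H w <= c%:E)%E].

Lemma moment_envelopeU d (T : measurableType d) (R : realType)
    (P : probability T R) (F G : set (T -> R)) p (a b : R) :
  moment_envelope P F p a -> moment_envelope P G p b ->
  moment_envelope P (F `|` G) p (a + b).
Proof.
move=> [H [mH H0 FH HE]] [I [mI I0 GI IE]].
exists (fun w => H w + I w)%E; split.
- exact: emeasurable_funD.
- by move=> w; rewrite adde_ge0.
- move=> f [Ff|Gf] w; [apply: le_trans (FH f Ff w) _|apply: le_trans (GI f Gf w) _].
    by rewrite leeDl.
  by rewrite leeDr.
- by rewrite ge0_integralD// EFinD leeD.
Qed.

Lemma moment_envelopeS d (T : measurableType d) (R : realType)
    (P : probability T R) (F G : set (T -> R)) p (a : R) :
  F `<=` G -> moment_envelope P G p a -> moment_envelope P F p a.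
Proof.
by move=> FG [H [mH H0 GH HE]]; exists H; split=> // f /FG; exact: GH.
Qed.

Section envelope.
Context d (T : measurableType d) (R : realType) (P : probability T R).
Variable xi : nat -> {RV P >-> R}.
Hypothesis xi_indep : mutually_independent [set k | (1 <= k)%N] xi.
Variable iota : nat -> nat.
Hypothesis iota_inj : injective iota.
Hypothesis iota_gt0 : forall j, (1 <= iota j)%N.
Variable f : nat -> R -> R.
Hypothesis mf : forall j, measurable_fun setT (f j).
Hypothesis f_mgf : forall j,
  (\int[P]_w (expR (f j (xi (iota j) w)))%:E <= 1)%E.

(** If the walk reaches [k] but not [k + 1] then [1 + walk <= k + 2]; summing
[(k + 2) ^ m] over the levels reached gives an envelope, whose mean is finite
because level [k] is reached with probability at most [expR (- k)]. *)
Lemma walk_envelope m :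
  moment_envelope P (range (walk xi iota f)) m (envelope_mean R m).
Proof.
pose A k := reaches xi iota f k%:R.
have mA k : measurable (A k) by exact: measurable_reaches.
pose h k w : \bar R := (k.+2%:R ^+ m * \1_(A k) w)%:E.
have h0 k w : (0 <= h k w)%E by rewrite lee_fin mulr_ge0 ?exprn_ge0.
have mh k : measurable_fun setT (h k).
  by apply/measurable_EFinP; exact: measurable_funM.
exists (fun w => \sum_(0 <= k <oo) h k w)%E; split.
- by apply: ge0_emeasurable_sum => // k x _ _; exact: h0.
- by move=> w; apply: nneseries_ge0 => k _ _; exact: h0.
- move=> _ [n _ <-] w; set s := Num.max 0 _.
  have s0 : 0 <= s by rewrite le_max lexx.
  have /andP[ks sk] := truncn_itv s0.
  set k := Num.truncn s in ks sk.
  have Ak : A k w.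
    move: ks; rewrite /s; have [w0|w0] := leP (walk xi iota f n w) 0.
      by move=> k0; exists 0%N; rewrite /walk big_geq.
    by move=> kw; exists n.
  apply: le_trans (@nneseries_lim_ge _ (h^~ w) xpredT 0 k.+1 _); last first.
    by move=> i _ _; exact: h0.
  rewrite big_nat_recr//=; apply: (@le_trans _ _ (h k w)); last first.
    by rewrite leeDr// sume_ge0.
  rewrite lee_fin /h indicE mem_set// mulr1.
  apply: lerXn2r; rewrite ?nnegrE ?ler0n//; first exact: addr_ge0.
  have -> : k.+2%:R = k.+1%:R + 1 :> R by rewrite natr1.
  by rewrite addrC lerD2r ltW.
- rewrite integral_nneseries//.
  apply: le_trans (nneseries_exprn_expR R m); apply: lee_nneseries.
    by move=> k _ _; apply: integral_ge0 => w _; exact: h0.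
  move=> k _; rewrite /h.
  under eq_integral do rewrite EFinM.
  rewrite ge0_integralZl ?lee_fin//; last first.
    exact/measurable_EFinP.
  rewrite integral_indic// setIT EFinM lee_wpmul2l// ?lee_fin ?exprn_ge0//.
  exact: reaches_tail.
Qed.

End envelope.

(** * Growth of the noise level *)

(** Summation by parts: the sum differs from [s n] times the last partial sum of
[v] by a combination of the partial sums with weights [s k.+1 - s k], whose total
is at most [s n]. *)
Lemma abel_bound (R : realDomainType) (s v : nat -> R) (W : R) (n : nat) :
  (forall i j, (i <= j)%N -> s i <= s j) -> 0 <= s 0 ->
  (forall j, (j <= n.+1)%N -> `|\sum_(0 <= i < j) v i| <= W) ->
  `|\sum_(0 <= i < n.+1) s i * v i| <= 2 * s n * W.
Proof.
move=> s_nd s0 vW.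
pose V j := \sum_(0 <= i < j) v i.
have W0 : 0 <= W by apply: le_trans (vW 0%N isT).
have key k : (k <= n)%N -> `|\sum_(0 <= i < k.+1) s i * v i - s k * V k.+1| <= s k * W.
  elim: k => [_|k IH kn].
    by rewrite /V !big_nat1 subrr normr0 mulr_ge0.
  have -> : \sum_(0 <= i < k.+2) s i * v i - s k.+1 * V k.+2 =
      (\sum_(0 <= i < k.+1) s i * v i - s k * V k.+1) - (s k.+1 - s k) * V k.+1.
    by rewrite /V big_nat_recr//= [in X in _ - s k.+1 * X]big_nat_recr//=; ring.
  apply: (le_trans (ler_normB _ _)).
  have -> : s k.+1 * W = s k * W + (s k.+1 - s k) * W by ring.
  rewrite lerD ?IH 1?ltnW// normrM ger0_norm ?subr_ge0 ?s_nd//.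
  by rewrite ler_wpM2l ?subr_ge0 ?s_nd// vW// ltnW.
have sn : 0 <= s n by apply: le_trans s0 _; exact: s_nd.
have -> : \sum_(0 <= i < n.+1) s i * v i =
  (\sum_(0 <= i < n.+1) s i * v i - s n * V n.+1) + s n * V n.+1 by ring.
apply: (le_trans (ler_normD _ _)).
have -> : 2 * s n * W = s n * W + s n * W by ring.
by rewrite lerD ?key// normrM (ger0_norm sn) ler_wpM2l//; exact: vW.
Qed.

Section polynomial_growth.
Context (R : realType) (beta : R) (sigma : nat -> R).
Hypothesis sigma_gt0 : forall k : nat, (1 <= k)%N -> 0 < sigma k.
Hypothesis sigma_poly : polynomial_hypothesis beta sigma.

Definition noise_level N : R := \sum_(1 <= i < N.+1) sigma i ^+ 2.

Let beta_ge0 : 0 <= beta. Proof. by case: sigma_poly. Qed.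

Let sigma_nd i j : (1 <= i)%N -> (i <= j)%N -> sigma i ^+ 2 <= sigma j ^+ 2.
Proof. by case: sigma_poly => _ _ + _; apply. Qed.

Let sqr_nd i j : (1 <= i)%N -> (i <= j)%N -> sigma i ^+ 4 <= sigma j ^+ 4.
Proof.
have E (x : R) : x ^+ 4 = (x ^+ 2) ^+ 2 by rewrite -exprM.
by move=> i1 ij; rewrite !E lerXn2r ?nnegrE ?sqr_ge0// sigma_nd.
Qed.

Lemma noise_level_ge N : N%:R * sigma 1 ^+ 2 <= noise_level N.
Proof.
rewrite -[N in leLHS]card_ord mulr_natl -sumr_const /noise_level.
rewrite (big_addn 0 _ 1) big_mkord subn1 /=.
by apply: ler_sum => i _; rewrite sigma_nd ?addn1.
Qed.

(** With [m] about [3 * k / 4], the lower bound of the hypothesis at [m] compares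
[sigma m ^+ 2] with a mean of the [sigma i ^+ 4] up to [2 * m], and a positive
fraction of these [i] are beyond [k]. So [sigma m ^+ 2] is of the order of
[sigma k ^+ 2], and so are the [k / 4] terms between [m] and [k]. *)
Lemma index_sqr_le_noise_level : exists2 A : R, 1 <= A &
  forall k, (1 <= k)%N -> k%:R * sigma k ^+ 2 <= A * noise_level k.
Proof.
have [_ _ _ [C1 [C2 [C3 [C10 C20 C30 H]]]]] := sigma_poly.
exists (1 + 8 / C1); first by rewrite lerDl divr_ge0// ltW.
move=> [//|[|k]] _.
  by rewrite /noise_level big_nat1 mul1r ler_peMl ?sqr_ge0// lerDl divr_ge0// ltW.
set n := k.+2; pose m := (n - n %/ 4)%N.
have m_gt1 : (1 < m)%N by rewrite /m /n; lia.
have n2m : (n < (2 * m).+1)%N by rewrite /m /n; lia.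
have mn : (m <= n)%N by rewrite /m; lia.
have Sm : n%:R / 4 * sigma m ^+ 2 <= noise_level n.
  rewrite /noise_level (@big_cat_nat _ _ _ m 1 n.+1)//=; last 2 first.
  - exact: ltnW.
  - exact: leqW.
  apply: (@le_trans _ _ (\sum_(m <= i < n.+1) sigma i ^+ 2)); last first.
    by rewrite lerDr sumr_ge0// => i _; exact: sqr_ge0.
  apply: (@le_trans _ _ (\sum_(m <= i < n.+1) sigma m ^+ 2)); last first.
    rewrite !big_nat; apply: ler_sum => i /andP[mi _].
    by rewrite sigma_nd// ltnW.
  rewrite sumr_const_nat -[leRHS]mulr_natl ler_wpM2r ?sqr_ge0//.
  rewrite ler_pdivrMr// -natrM ler_nat /m; lia.
have avg : sigma n ^+ 2 / 2 <=
    Num.sqrt ((2 * m)%:R^-1 * \sum_(1 <= i < (2 * m).+1) sigma i ^+ 4).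
  rewrite -[leLHS]ger0_norm ?divr_ge0 ?sqr_ge0// -sqrtr_sqr ler_wsqrtr//.
  rewrite [leRHS]mulrC ler_pdivlMr ?ltr0n ?muln_gt0 ?(ltnW m_gt1)//.
  rewrite (@big_cat_nat _ _ _ n 1 (2 * m).+1)//=; last exact: ltnW.
  apply: (@le_trans _ _ (\sum_(n <= i < (2 * m).+1) sigma i ^+ 4)); last first.
    by rewrite lerDr sumr_ge0// => i _; rewrite exprn_even_ge0.
  apply: (@le_trans _ _ (\sum_(n <= i < (2 * m).+1) sigma n ^+ 4)); last first.
    rewrite !big_nat; apply: ler_sum => i /andP[ni _].
    exact: sqr_nd.
  rewrite sumr_const_nat -[leRHS]mulr_natl.
  have -> : (sigma n ^+ 2 / 2) ^+ 2 * (2 * m)%:R = (2 * m)%:R / 4 * sigma n ^+ 4.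
    by field.
  rewrite ler_wpM2r ?exprn_even_ge0// ler_pdivrMr// -natrM ler_nat /m; lia.
have [C1m _ _] := H _ m_gt1.
have {}C1m : C1 * (sigma n ^+ 2 / 2) <= sigma m ^+ 2.
  by apply: le_trans C1m; rewrite ler_pM2l.
have n0 : 0 < n%:R :> R by rewrite ltr0n.
apply: (@le_trans _ _ (8 / C1 * noise_level n)); last first.
  by rewrite ler_wpM2r ?lerDr// sumr_ge0// => i _; exact: sqr_ge0.
rewrite mulrAC ler_pdivlMr//; apply: le_trans (ler_wpM2l _ Sm); last by [].
have -> : 8 * (n%:R / 4 * sigma m ^+ 2) = n%:R * (2 * sigma m ^+ 2) by field.
by rewrite -mulrA ler_pM2l//; lra.
Qed.

Definition budget (dl : R) : R := sigma 1 ^+ 2 * (dl `^ (4 * beta + 1))^-1.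

(** With [x] the quotient of the noise level by [sigma 1 ^+ 2] and
[p = 2 * beta / (2 * beta + 1)], the upper bound of the hypothesis is
[sigma N ^+ 2 <= C2 * sigma 1 ^+ 2 * x `^ p]. If [a * C2 * x `^ p <= dl ^+ 2 * x]
the first term on the right is enough. Otherwise
[x `^ (1 - p) <= a * C2 / dl ^+ 2], and raising this to the power [2 * beta] gives
[x `^ p <= (a * C2 / dl ^+ 2) `^ (2 * beta)]; the left side is then a multiple of
[a `^ (2 * beta + 1) * dl `^ (- (4 * beta + 1))]. *)
Lemma young_noise_level : exists2 K : R, 1 <= K &
  forall (m : nat) (N : nat) (dl a : R), 2 * beta + 1 <= m%:R -> (1 <= N)%N ->
    0 < dl -> dl <= 1 -> 1 <= a ->
    a * sigma N ^+ 2 / dl <= dl * noise_level N + K * a ^+ m * budget dl.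
Proof.
have [_ _ _ [C1 [C2 [C3 [C10 C20 C30 H]]]]] := sigma_poly.
have b1 : 0 < 2 * beta + 1 by move: beta_ge0; lra.
exists (1 + C2 `^ (2 * beta + 1)); first by rewrite lerDl powR_ge0.
move=> m N dl a bm N1 dl0 dl1 a1.
have a0 : 0 < a by lra.
have s0 : 0 < sigma 1 ^+ 2 by rewrite exprn_gt0// sigma_gt0.
pose D := (dl `^ (4 * beta + 1))^-1.
have D0 : 0 < D by rewrite invr_gt0 powR_gt0.
have am : a `^ (2 * beta + 1) <= a ^+ m.
  by rewrite -powR_mulrn ?(ltW a0)// ler_powR.
have am0 : 0 <= a ^+ m by rewrite exprn_ge0// ltW.
have S0 : 0 <= dl * noise_level N.
  by rewrite mulr_ge0 ?(ltW dl0)// sumr_ge0// => i _; exact: sqr_ge0.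
have KD0 : 0 <= C2 `^ (2 * beta + 1) * a ^+ m * budget dl.
  by rewrite mulr_ge0// mulr_ge0 ?powR_ge0// ltW.
case: N N1 S0 => [//|[|k]] _ S0.
  rewrite -[leLHS]add0r lerD// /budget -/D.
  apply: (@le_trans _ _ (a ^+ m * (sigma 1 ^+ 2 * D))); last first.
    rewrite -mulrA mulrDl mul1r lerDl.
    by apply: le_trans KD0 _; rewrite /budget -/D !mulrA.
  rewrite -mulrA ler_pM//; [exact: ltW|by rewrite mulr_ge0 ?ltW ?invr_gt0| |].
    apply: le_trans am; apply: le1r_powR => //; move: beta_ge0; lra.
  rewrite ler_pM2l// /D lef_pV2 ?posrE ?powR_gt0//.
  by apply: ge1r_powR; rewrite ?dl0//; move: beta_ge0; lra.
set N := k.+2 in S0 *.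
pose x := (sigma 1 ^+ 2)^-1 * \sum_(1 <= i < N) sigma i ^+ 2.
have x1 : 1 <= x.
  rewrite /x ler_pdivlMl// mulr1 big_ltn// lerDl sumr_ge0// => i _.
  exact: sqr_ge0.
have x0 : 0 < x by lra.
have Sx : sigma 1 ^+ 2 * x <= noise_level N.
  by rewrite /x mulVKf ?gt_eqF// /noise_level [leRHS]big_nat_recr//= lerDl sqr_ge0.
have [_ sN _] := H N isT.
set p := 2 * beta / (2 * beta + 1) in sN.
rewrite -/x in sN.
pose q := (2 * beta + 1)^-1.
have pq : p + q = 1 by rewrite /p /q; field; rewrite gt_eqF.
have xpq : x = x `^ p * x `^ q by rewrite -powRD ?pq ?powRr1 ?oner_eq0// ltW.
apply: (@le_trans _ _ (sigma 1 ^+ 2 * (a * C2 * x `^ p / dl))).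
  have -> : sigma 1 ^+ 2 * (a * C2 * x `^ p / dl) =
      a * (C2 * sigma 1 ^+ 2 * x `^ p) / dl by ring.
  by rewrite ler_pM2r ?invr_gt0// ler_pM2l.
suff {sN}: a * C2 * x `^ p / dl <= dl * x + C2 `^ (2 * beta + 1) * a ^+ m * D.
  move=> /(ler_wpM2l (ltW s0)) /le_trans; apply.
  have -> : sigma 1 ^+ 2 * (dl * x + C2 `^ (2 * beta + 1) * a ^+ m * D) =
      dl * (sigma 1 ^+ 2 * x) +
      C2 `^ (2 * beta + 1) * a ^+ m * (sigma 1 ^+ 2 * D) by ring.
  rewrite lerD ?ler_pM2l// /budget -/D ler_wpM2r//.
    by rewrite mulr_ge0// ltW.
  by rewrite ler_wpM2r// lerDr.
have [h|h] := leP (a * C2 * x `^ p) (dl ^+ 2 * x).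
  apply: (@le_trans _ _ (dl * x)).
    by rewrite ler_pdivrMr//; apply: le_trans h _; rewrite expr2; lra.
  by rewrite lerDl !mulr_ge0 ?powR_ge0// ltW.
have aC0 : 0 < a * C2 by rewrite mulr_gt0.
have xp0 : 0 < x `^ p by rewrite powR_gt0.
have xq : x `^ q <= a * C2 / dl ^+ 2.
  rewrite ler_pdivlMr ?exprn_gt0// -(ler_pM2r xp0).
  have -> : x `^ q * dl ^+ 2 * x `^ p = dl ^+ 2 * (x `^ p * x `^ q) by ring.
  by rewrite -xpq ltW.
have xp : x `^ p <= (a * C2) `^ (2 * beta) * dl `^ (- (4 * beta)).
  have -> : x `^ p = (x `^ q) `^ (2 * beta).
    by rewrite -powRrM /p /q mulrC.
  have -> : (a * C2) `^ (2 * beta) * dl `^ (- (4 * beta)) =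
      (a * C2 / dl ^+ 2) `^ (2 * beta).
    rewrite [RHS]powRM ?(ltW aC0) ?invr_ge0 ?sqr_ge0//; congr (_ * _).
    rewrite -powR_invn ?(ltW dl0)// -powRrM; congr (_ `^ _); ring.
  apply: ge0_ler_powR; rewrite ?nnegrE ?powR_ge0 ?divr_ge0 ?sqr_ge0 ?(ltW aC0)//.
  exact: mulr_ge0.
apply: (@le_trans _ _ (C2 `^ (2 * beta + 1) * a ^+ m * D)); last first.
  by rewrite lerDr mulr_ge0 ?ltW.
apply: (@le_trans _ _ ((a * C2) `^ (2 * beta + 1) * D)); last first.
  rewrite ler_pM2r// powRM ?(ltW a0) ?(ltW C20)// mulrC ler_wpM2l ?powR_ge0//.
have -> : (a * C2) `^ (2 * beta + 1) * D =
    a * C2 * ((a * C2) `^ (2 * beta) * dl `^ (- (4 * beta))) / dl.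
  have split y z : 0 < y -> y `^ (z + 1) = y `^ z * y :> R.
    by move=> y0; rewrite powRD ?powRr1 ?(ltW y0)// (gt_eqF y0) implybT.
  by rewrite /D !split// powRN invfM; ring.
by rewrite ler_pM2r ?invr_gt0// ler_pM2l.
Qed.

End polynomial_growth.

(** * Bounds on one path *)

Lemma exists_argmin_nat (R : realDomainType) (c : nat -> R) (n : nat) :
  (forall N, (n <= N)%N -> c 1%N <= c N) ->
  exists2 N, (1 <= N)%N & forall M, (1 <= M)%N -> c N <= c M.
Proof.
move=> cn; pose i0 : 'I_n.+1 := ord0.
case: (@arg_minP _ _ _ i0 xpredT (fun i => c i.+1) isT) => i _ imin.
exists i.+1 => // -[//|M] _; have [Mn|nM] := ltnP M n.+1.
  exact: (imin (Ordinal Mn)).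
apply: le_trans (imin i0 isT) _; apply: cn; lia.
Qed.

(** Steps of the driving walks; the drift subtracted in each of them brings its
exponential moment down to at most 1. *)
Definition sqr_step (R : realType) (kp : R) (e : bool) (x : R) : R :=
  kp / 4 * ((-1) ^+ e * (x ^+ 2 - 1)) - kp ^+ 2 / 4.

Definition forward_step (R : realType) (theta : nat -> R) (N0 : nat) (b : R)
    (e : bool) (j : nat) (x : R) : R :=
  b^-1 * ((-1) ^+ e * (theta (N0 + j.+1)%N * x)) -
  (b^-1 * theta (N0 + j.+1)%N) ^+ 2 / 2.

Definition backward_step (R : realType) (sigma theta : nat -> R) (N0 : nat)
    (dl : R) (j : nat) (x : R) : R :=
  dl / (2 * sigma N0 ^+ 2) *
  (- (2 * (sigma (N0 - j)%N * (theta (N0 - j)%N * x))) -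
   dl * theta (N0 - j)%N ^+ 2).

Section pathwise.
Context (R : realType) (beta : R) (sigma : nat -> R).
Hypothesis sigma_gt0 : forall k : nat, (1 <= k)%N -> 0 < sigma k.
Hypothesis sigma_nd : forall i j, (1 <= i)%N -> (i <= j)%N -> sigma i <= sigma j.

Variables (A K : R) (m : nat).
Hypothesis A1 : 1 <= A.
Hypothesis A_bound : forall k, (1 <= k)%N ->
  k%:R * sigma k ^+ 2 <= A * noise_level sigma k.
Hypothesis K1 : 1 <= K.
Variable dl : R.
Hypotheses (dl0 : 0 < dl) (dl1 : dl <= 1).
Hypothesis K_bound : forall N a, (1 <= N)%N -> 1 <= a ->
  a * sigma N ^+ 2 / dl <= dl * noise_level sigma N + K * a ^+ m * budget beta sigma dl.
Hypothesis beta_ge0 : 0 <= beta.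

(** The constant [64 * A] covers the three values given to [a] in
[young_noise_level]: [64 * A * g], [9 * g ^+ 2] and [2 * g]. *)
Definition excess : R := K * (64 * A) ^+ m * budget beta sigma dl.

Lemma budget_ge : sigma 1 ^+ 2 <= budget beta sigma dl.
Proof.
rewrite ler_peMr ?sqr_ge0// invf_ge1 ?powR_gt0//.
have /ger_powR h : 0 < dl <= 1 by rewrite dl0.
have /h : 0 <= 4 * beta + 1 by move: beta_ge0; lra.
by rewrite powRr0.
Qed.

Let budget_ge0 : 0 <= budget beta sigma dl.
Proof. by apply: le_trans budget_ge; exact: sqr_ge0. Qed.

Lemma excess_ge : sigma 1 ^+ 2 <= excess.
Proof.
apply: le_trans budget_ge _; rewrite ler_peMl// mulr_ege1//.
by rewrite exprn_ege1//; move: A1; lra.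
Qed.

Variable g : R.
Hypothesis g1 : 1 <= g.

Let le_excess a : 1 <= a -> a <= 64 * A * g ^+ 2 ->
  K * a ^+ m * budget beta sigma dl <= excess * g ^+ (2 * m).
Proof.
have ? := A1; have ? := K1.
move=> a1 ag; rewrite /excess [leRHS]mulrAC ler_wpM2r//.
rewrite -mulrA ler_wpM2l//; first by lra.
rewrite exprM -exprMn lerXn2r ?nnegrE//; first by lra.
by apply: le_trans ag; lra.
Qed.

Variable x : nat -> R.

(** With [kp = dl / (4 * A)], the sums of the [x i ^+ 2 - 1] up to [N] are at most
[kp * N + 4 * g / kp]. After summation by parts [kp * N * sigma N ^+ 2] is a
fraction of [dl] times the noise level, by [A_bound], and [g * sigma N ^+ 2 / kp]
is left to [K_bound]. *)
Lemma eta_pathwise N : (1 <= N)%N ->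
  (forall n e, \sum_(0 <= j < n) sqr_step (dl / (4 * A)) e (x j.+1) <= g) ->
  `|\sum_(1 <= i < N.+1) sigma i ^+ 2 * (x i ^+ 2 - 1)| <=
    dl * noise_level sigma N + excess * g ^+ (2 * m).
Proof.
have ? := A1; have ? := K1; have ? := g1; have ? := dl0.
case: N => // n _ xg.
pose kp := dl / (4 * A).
have A0 : 0 < A by lra.
have kp0 : 0 < kp by rewrite divr_gt0// mulr_gt0.
have Tb j : `|\sum_(0 <= i < j) (x i.+1 ^+ 2 - 1)| <= kp * j%:R + 4 * g / kp.
  have Tb (b : bool) : (-1) ^+ b * \sum_(0 <= i < j) (x i.+1 ^+ 2 - 1) <=
      kp * j%:R + 4 * g / kp.
    have := xg j b; rewrite /sqr_step -/kp sumrB -!mulr_sumr sumr_const_nat subn0.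
    set t := _ * \sum_(_ <= _ < _) _ => h.
    have -> : kp * j%:R + 4 * g / kp = (kp ^+ 2 / 4 *+ j + g) / (kp / 4).
      by rewrite -mulr_natr; field; rewrite gt_eqF.
    by rewrite ler_pdivlMr ?divr_gt0//; lra.
  have := Tb true; have := Tb false; rewrite expr0 expr1 mul1r mulN1r => h1 h2.
  by rewrite ler_norml; apply/andP; split; lra.
rewrite big_add1 /=.
apply: le_trans (@abel_bound _ (fun i => sigma i.+1 ^+ 2) (fun i => x i.+1 ^+ 2 - 1)
   (kp * n.+1%:R + 4 * g / kp) n _ _ _) _.
- by move=> i j ij; rewrite lerXn2r ?nnegrE ?(ltW (sigma_gt0 _))// sigma_nd.
- exact: sqr_ge0.
- move=> j jn; apply: le_trans (Tb j) _.
  by rewrite lerD2r ler_pM2l// ler_nat.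
have Ag : 1 <= 64 * A * g by nra.
have Sn := A_bound (ltn0Sn n).
have young := K_bound (ltn0Sn n) Ag.
have Q0 : K * (64 * A * g) ^+ m * budget beta sigma dl <= excess * g ^+ (2 * m).
  by apply: le_excess => //; rewrite expr2; nra.
have -> : 2 * sigma n.+1 ^+ 2 * (kp * n.+1%:R + 4 * g / kp) =
    2 * kp * (n.+1%:R * sigma n.+1 ^+ 2) + (64 * A * g * sigma n.+1 ^+ 2 / dl) / 2.
  by rewrite /kp; field; rewrite !gt_eqF.
have : 2 * kp * (n.+1%:R * sigma n.+1 ^+ 2) <= dl * noise_level sigma n.+1 / 2.
  have -> : dl * noise_level sigma n.+1 / 2 = 2 * kp * (A * noise_level sigma n.+1).
    by rewrite /kp; field; rewrite !gt_eqF.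
  by rewrite ler_pM2l// mulr_gt0.
have : 0 <= excess * g ^+ (2 * m).
  by apply: le_trans Q0; rewrite mulr_ge0// mulr_ge0 ?exprn_ge0//; lra.
lra.
Qed.

(** Summation by parts leaves [6 * sigma N * b * g], which the inequality
[2 * u * v <= u ^+ 2 + v ^+ 2] splits into [dl * b ^+ 2] and a term for
[K_bound]. *)
Lemma forward_pathwise N0 n (theta : nat -> R) (b : R) : 0 < b ->
  (forall k, \sum_(0 <= j < k) theta (N0 + j.+1)%N ^+ 2 <= b ^+ 2) ->
  (forall k e,
    \sum_(0 <= j < k) forward_step theta N0 b e j (x (N0 + j.+1)%N) <= g) ->
  `|2 * \sum_(0 <= j < n.+1)
          sigma (N0 + j.+1)%N * (theta (N0 + j.+1)%N * x (N0 + j.+1)%N)| <=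
    dl * b ^+ 2 + dl * noise_level sigma (N0 + n.+1) + excess * g ^+ (2 * m).
Proof.
have ? := g1; have ? := A1; have ? := dl0.
move=> b0 thb xg.
have Ub j : `|\sum_(0 <= i < j) theta (N0 + i.+1)%N * x (N0 + i.+1)%N| <= 3 / 2 * b * g.
  have Ub (e : bool) :
      (-1) ^+ e * \sum_(0 <= i < j) theta (N0 + i.+1)%N * x (N0 + i.+1)%N <=
      3 / 2 * b * g.
    have := xg j e; rewrite /forward_step sumrB -!mulr_sumr -mulr_suml.
    under [X in _ - X / 2 <= _]eq_bigr do rewrite exprMn.
    rewrite -mulr_sumr; set t := _ * \sum_(_ <= _ < _) (_ * _).
    set v := \sum_(_ <= _ < _) _; have vb : v <= b ^+ 2 by exact: thb.
    have : b^-1 ^+ 2 * v <= 1.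
      by rewrite exprVn mulrC ler_pdivrMr ?exprn_gt0// mul1r.
    move=> h1 h2; have : b^-1 * t <= 3 / 2 * g by lra.
    by rewrite mulrC ler_pdivrMr// => h; apply: le_trans h _; lra.
  have := Ub true; have := Ub false; rewrite expr0 expr1 mul1r mulN1r => h1 h2.
  by rewrite ler_norml; apply/andP; split; lra.
rewrite normrM ger0_norm//.
have s0 : 0 < sigma (N0 + n.+1)%N by apply: sigma_gt0; lia.
have := @abel_bound _ (fun i => sigma (N0 + i.+1)%N)
   (fun i => theta (N0 + i.+1)%N * x (N0 + i.+1)%N) (3 / 2 * b * g) n.
move=> /(_ _ _ (fun j _ => Ub j)) abel.
have {abel} :
    2 * `|\sum_(0 <= j < n.+1)
            sigma (N0 + j.+1)%N * (theta (N0 + j.+1)%N * x (N0 + j.+1)%N)| <=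
    6 * sigma (N0 + n.+1)%N * b * g.
  have -> : 6 * sigma (N0 + n.+1)%N * b * g =
      2 * (2 * sigma (N0 + n.+1)%N * (3 / 2 * b * g)) by field.
  rewrite ler_pM2l//; apply: abel => [i j ij|]; first by apply: sigma_nd; lia.
  by rewrite ltW// sigma_gt0//; lia.
move=> /le_trans; apply.
have g2 : 1 <= 9 * g ^+ 2 by rewrite expr2; nra.
have N1 : (1 <= N0 + n.+1)%N by lia.
have young := K_bound N1 g2.
have Q0 : K * (9 * g ^+ 2) ^+ m * budget beta sigma dl <= excess * g ^+ (2 * m).
  by apply: le_excess => //; rewrite ler_wpM2r ?sqr_ge0//; lra.
have : 6 * sigma (N0 + n.+1)%N * b * g <=
    dl * b ^+ 2 + 9 * g ^+ 2 * sigma (N0 + n.+1)%N ^+ 2 / dl.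
  have -> : dl * b ^+ 2 + 9 * g ^+ 2 * sigma (N0 + n.+1)%N ^+ 2 / dl =
     6 * sigma (N0 + n.+1)%N * b * g + (dl * b - 3 * sigma (N0 + n.+1)%N * g) ^+ 2 / dl.
    by field; rewrite gt_eqF.
  by rewrite lerDl divr_ge0 ?sqr_ge0// ltW.
lra.
Qed.

(** Downwards from [N0] the increment has to be compared with the energy of [theta]
that it has crossed, the only part of the energy of [theta] that the loss at the
lower end sees; the drift of the walk consists of exactly this energy. *)
Lemma backward_pathwise N0 n (theta : nat -> R) : (1 <= N0)%N ->
  \sum_(0 <= j < n) backward_step sigma theta N0 dl j (x (N0 - j)%N) <= g ->
  - (2 * \sum_(0 <= j < n)
           sigma (N0 - j)%N * (theta (N0 - j)%N * x (N0 - j)%N)) <=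
    dl * \sum_(0 <= j < n) theta (N0 - j)%N ^+ 2 + dl * noise_level sigma N0 +
    excess * g ^+ (2 * m).
Proof.
have ? := g1; have ? := A1; have ? := dl0.
move=> N1; rewrite /backward_step -mulr_sumr sumrB sumrN -!mulr_sumr.
set X := 2 * \sum_(_ <= _ < _) _; set Y := dl * \sum_(_ <= _ < _) _ => h.
have s0 : 0 < sigma N0 by exact: sigma_gt0.
have {}h : - X - Y <= 2 * g * sigma N0 ^+ 2 / dl.
  have -> : 2 * g * sigma N0 ^+ 2 / dl = g / (dl / (2 * sigma N0 ^+ 2)).
    by field; rewrite !gt_eqF.
  by rewrite ler_pdivlMr ?divr_gt0 ?mulr_gt0 ?exprn_gt0// mulrC.
have g2 : 1 <= 2 * g by lra.
have young := K_bound N1 g2.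
have Q0 : K * (2 * g) ^+ m * budget beta sigma dl <= excess * g ^+ (2 * m).
  by apply: le_excess => //; rewrite expr2; nra.
lra.
Qed.

End pathwise.

(** * The oracle inequality on one path *)

Section oracle_pathwise.
Context (R : realType) (sigma theta x tail pen : nat -> R) (dl Q : R).

Definition fluct N : R := \sum_(1 <= i < N.+1) sigma i ^+ 2 * (x i ^+ 2 - 1).
Definition cross N : R := \sum_(1 <= i < N.+1) sigma i * (theta i * x i).
Definition criterion N : R :=
  - (\sum_(1 <= k < N.+1) (theta k + sigma k * x k) ^+ 2) +
  2 * \sum_(1 <= k < N.+1) sigma k ^+ 2 + pen N.
Definition noise_energy N : R := \sum_(1 <= k < N.+1) (sigma k * x k) ^+ 2.

Hypothesis pen_ge0 : forall N, 0 <= pen N.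
Hypothesis tail_ge0 : forall N, 0 <= tail N.
Hypothesis tailE : forall M N, (M <= N)%N ->
  tail M = \sum_(M.+1 <= k < N.+1) theta k ^+ 2 + tail N.
Hypotheses (dl_gt0 : 0 < dl) (dl_le : dl <= 8^-1).
Hypothesis Q_ge : sigma 1 ^+ 2 <= Q.
Hypothesis fluctP : forall N, (1 <= N)%N -> `|fluct N| <= dl * noise_level sigma N + Q.
Variable N0 : nat.
Hypothesis cross_fwd : forall N, (N0 < N)%N ->
  `|2 * (cross N - cross N0)| <=
    dl * (tail N0 + sigma 1 ^+ 2) + dl * noise_level sigma N + Q.
Hypothesis cross_bwd : forall N, (N <= N0)%N ->
  2 * (cross N - cross N0) <= dl * (tail N - tail N0) + dl * noise_level sigma N0 + Q.

Lemma noise_energyE N : noise_energy N = fluct N + noise_level sigma N.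
Proof.
rewrite /noise_energy /fluct /noise_level -big_split /=; apply: eq_bigr => i _.
by rewrite exprMn; ring.
Qed.

Lemma criterionE N : criterion N =
  tail N + noise_level sigma N - 2 * cross N - fluct N + pen N - tail 0%N.
Proof.
rewrite (tailE (leq0n N)) /criterion.
have -> : \sum_(1 <= k < N.+1) (theta k + sigma k * x k) ^+ 2 =
    \sum_(1 <= k < N.+1) theta k ^+ 2 + 2 * cross N + fluct N + noise_level sigma N.
  rewrite /cross /fluct /noise_level mulr_sumr -!big_split /=.
  by apply: eq_bigr => i _; ring.
rewrite -/(noise_level sigma N); ring.
Qed.

Let noise_level_ge0 N : 0 <= noise_level sigma N.
Proof. by apply: sumr_ge0 => i _; exact: sqr_ge0. Qed.

Lemma cross_increment N : (1 <= N)%N -> 2 * (cross N - cross N0) <=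
  dl * (tail N + noise_level sigma N) + dl * (tail N0 + noise_level sigma N0) +
  dl * sigma 1 ^+ 2 + Q.
Proof.
have ? := dl_gt0; have ? := tail_ge0 N; have ? := tail_ge0 N0.
have ? := noise_level_ge0 N; have ? := noise_level_ge0 N0.
have ? : 0 <= dl * tail N by rewrite mulr_ge0// ltW.
have ? : 0 <= dl * tail N0 by rewrite mulr_ge0// ltW.
have ? : 0 <= dl * noise_level sigma N by rewrite mulr_ge0// ltW.
have ? : 0 <= dl * noise_level sigma N0 by rewrite mulr_ge0// ltW.
have ? : 0 <= dl * sigma 1 ^+ 2 by rewrite mulr_ge0 ?sqr_ge0// ltW.
move=> N1; have [N0N|NN0] := ltnP N0 N.
  by have := le_trans (ler_norm _) (cross_fwd N0N); lra.
by have := cross_bwd NN0; lra.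
Qed.

(** Minimality bounds [tail N + noise_level sigma N] by the risk at [N0] minus
[fluct N0], plus [fluct N + 2 * (cross N - cross N0)]; at most a fraction
[2 * dl] of the left side is lost in the last terms. The term [fluct N0] has a
small mean but no small bound, and is therefore kept, inside
[noise_energy N0]. *)
Lemma oracle_pathwise N : (1 <= N)%N -> criterion N <= criterion N0 ->
  (1 - 2 * dl) * (tail N + noise_energy N) + (1 + dl) * noise_energy N0 <=
  (1 + dl) ^+ 2 * (tail N0 + noise_level sigma N0 + pen N0) +
  (1 + dl) * noise_level sigma N0 + 5 * Q.
Proof.
move=> N1; rewrite !criterionE !noise_energyE.
have := cross_increment N1.
have := fluctP N1; rewrite ler_norml => /andP[_].
have := pen_ge0 N; have := pen_ge0 N0.
set L := tail N + noise_level sigma N.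
have := noise_level_ge0 N; have := tail_ge0 N.
have := noise_level_ge0 N0; have := tail_ge0 N0; have := dl_gt0; have := dl_le.
have : dl * sigma 1 ^+ 2 <= Q.
  apply: le_trans Q_ge; rewrite ler_piMl ?sqr_ge0//.
  by have := dl_le; lra.
have Q0 : 0 <= Q by apply: le_trans Q_ge; exact: sqr_ge0.
move: Q0 (dl * sigma 1 ^+ 2).
rewrite /L; move: (tail N) (noise_level sigma N) (tail N0).
move: (noise_level sigma N0) (pen N) (pen N0) => s0 p p0 t s t0.
move: (fluct N) (fluct N0) (cross N) (cross N0) => f f0 c c0 Q0 u.
move=> uQ d8 d0 t00 s00 tt ss pp0 pp h1 h2 h3.
have ? : 0 <= dl * t by rewrite mulr_ge0// ltW.
have key : (1 - 2 * dl) * (t + s) <= (1 + dl) * (t0 + s0 + p0) - f0 + 3 * Q.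
  have ? : 0 <= dl * p0 by rewrite mulr_ge0// ltW.
  lra.
have l1 : f <= dl * (t + s) + Q by lra.
have l2 : (1 - 2 * dl) * f <= (1 - 2 * dl) * (dl * (t + s) + Q).
  by rewrite ler_wpM2l//; lra.
have l3 : (1 + dl) * ((1 - 2 * dl) * (t + s)) <=
    (1 + dl) * ((1 + dl) * (t0 + s0 + p0) - f0 + 3 * Q).
  by rewrite ler_pM2l//; lra.
have ? : dl * Q <= 8^-1 * Q by rewrite ler_wpM2r.
have ? : 0 <= dl * Q by rewrite mulr_ge0// ltW.
rewrite expr2; lra.
Qed.

Hypothesis noise_level_lin : forall N, N%:R * sigma 1 ^+ 2 <= noise_level sigma N.
Hypothesis sigma1 : 0 < sigma 1 ^+ 2.

(** The noise level grows at least linearly, and the fluctuations consume only a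
fraction of it: the criterion tends to infinity. *)
Lemma criterion_attained : exists2 N, (1 <= N)%N &
  forall M, (1 <= M)%N -> criterion N <= criterion M.
Proof.
pose c := tail 0%N + criterion 1 + 2 * cross N0 + 2 * Q + dl * (tail 0%N + tail N0) +
   dl * noise_level sigma N0 + dl * sigma 1 ^+ 2.
pose n := maxn 1 (Num.truncn (2 * c / sigma 1 ^+ 2)).+1.
apply: (@exists_argmin_nat _ _ n) => N nN.
have N1 : (1 <= N)%N by apply: leq_trans nN; rewrite leq_maxl.
have ? := dl_gt0; have ? := dl_le.
have cN : c <= noise_level sigma N / 2.
  rewrite ler_pdivlMr// mulrC; apply: le_trans (noise_level_lin N).
  rewrite -ler_pdivrMr//; apply/ltW/(lt_le_trans (truncnS_gt _)).
  by rewrite ler_nat; apply: leq_trans nN; rewrite leq_maxr.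
have := cross_increment N1.
have := fluctP N1; rewrite ler_norml => /andP[_].
rewrite (criterionE N); have ? := pen_ge0 N; have ? := tail_ge0 N.
have tN : tail N <= tail 0%N.
  by rewrite (tailE (leq0n N)) lerDr sumr_ge0// => i _; exact: sqr_ge0.
have ? : dl * tail N <= dl * tail 0%N by rewrite ler_pM2l.
have ? : dl * noise_level sigma N <= 8^-1 * noise_level sigma N by rewrite ler_wpM2r.
have ? := noise_level_ge0 N.
move: cN; rewrite /c; lra.
Qed.

End oracle_pathwise.

(** * Losses and penalties *)

Lemma measurable_nat_index d d' (T : measurableType d) (U : measurableType d')
    (F : nat -> T -> U) (N : T -> nat) :
  (forall n, measurable_fun setT (F n)) -> measurable_fun setT N ->
  measurable_fun setT (fun w => F (N w) w).
Proof.
move=> mF mN _ B mB; rewrite setTI.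
rewrite (_ : _ @^-1` B = \bigcup_n (N @^-1` [set n] `&` F n @^-1` B)).
  apply: bigcupT_measurable => n; apply: measurableI.
    by rewrite -[_ @^-1` _]setTI; exact: mN.
  by rewrite -[_ @^-1` _]setTI; exact: mF.
by apply/seteqP; split=> [w FB|w [n _ [<-]]]//; exists (N w).
Qed.

Lemma U0_ge0 d (T : measurableType d) (R : realType) (P : probability T R)
  (sigma : nat -> R) (xi : nat -> {RV P >-> R}) N : 0 <= U0 sigma xi N.
Proof.
rewrite /U0; set S := [set t : R | _].
have [S0|S0] := pselect (S !=set0).
  by apply: lb_le_inf => // t [/ltW].
by rewrite inf_out// => -[].
Qed.

Section tail.
Context (R : realType) (theta : nat -> R).
Hypothesis theta_l2 : (l2_sqnorm theta < +oo)%E.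

Definition tail_energy N : R := fine (\sum_(N.+1 <= k <oo) (theta k ^+ 2)%:E)%E.

Let sq0 k : (0 <= (theta k ^+ 2)%:E)%E. Proof. by rewrite lee_fin sqr_ge0. Qed.

Lemma tail_energyE N :
  (\sum_(N.+1 <= k <oo) (theta k ^+ 2)%:E = (tail_energy N)%:E)%E.
Proof.
rewrite /tail_energy fineK// ge0_fin_numE; last by apply: nneseries_ge0.
apply: le_lt_trans theta_l2; rewrite /l2_sqnorm.
rewrite [leRHS](@nneseries_split _ _ 1 N)// add1n.
by rewrite leeDr// sume_ge0.
Qed.

Lemma tail_energy_ge0 N : 0 <= tail_energy N.
Proof. by rewrite fine_ge0// nneseries_ge0. Qed.

Lemma tail_energy_split M N : (M <= N)%N ->
  tail_energy M = \sum_(M.+1 <= k < N.+1) theta k ^+ 2 + tail_energy N.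
Proof.
move=> MN; apply/EFin_inj; rewrite EFinD -!tail_energyE -sumEFin.
rewrite (@nneseries_split _ _ M.+1 (N - M))//.
by rewrite addSn subnKC.
Qed.

Lemma l2_loss (sigma x : nat -> R) N :
  (l2_sqnorm (fun k =>
     proj_estimator (fun k => theta k + sigma k * x k) N k - theta k)%R =
  (tail_energy N + noise_energy sigma x N)%:E)%E.
Proof.
rewrite /l2_sqnorm (@nneseries_split _ _ 1 N); last first.
  by move=> k _; rewrite lee_fin sqr_ge0.
rewrite add1n addrC EFinD -tail_energyE; congr (_ + _)%E.
  rewrite eseries_cond [RHS]eseries_cond; apply: eq_eseriesr => k /andP[_ Nk].
  by rewrite /proj_estimator leqNgt Nk/= sub0r sqrrN.
rewrite /noise_energy -sumEFin !big_nat; apply: eq_bigr => k /andP[_ kN].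
by rewrite /proj_estimator -ltnS kN addrC addKr.
Qed.

End tail.

(** * The driving walks *)

Section gaussian_steps.
Context d (T : measurableType d) (R : realType) (P : probability T R).
Variable X : {RV P >-> R}.
Hypothesis XN : forall B : set R, measurable B ->
  distribution P X B = normal_prob 0 1 B.

Lemma expectation_expRB (f : T -> R) (a c : R) : measurable_fun setT f ->
  (\int[P]_w (expR (f w))%:E <= (expR a)%:E)%E -> a <= c ->
  (\int[P]_w (expR (f w - c))%:E <= 1)%E.
Proof.
move=> mf fa ac.
under eq_integral do rewrite expRD EFinM muleC.
rewrite ge0_integralZl//; last first.
  by apply/measurable_EFinP; exact: measurableT_comp.
apply: le_trans (lee_wpmul2l _ fa) _; first by rewrite lee_fin expR_ge0.
by rewrite -EFinM lee_fin -expRD -expR0 ler_expR; lra.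
Qed.

Lemma normal_step_mgf (a c : R) : a ^+ 2 / 2 <= c ->
  (\int[P]_w (expR (a * X w - c))%:E <= 1)%E.
Proof.
apply: expectation_expRB; last by rewrite normal_mgf.
exact: measurable_funM.
Qed.

Lemma normal_sqr_step_mgf (l c : R) : l <= 4^-1 -> 4 * l ^+ 2 <= c ->
  (\int[P]_w (expR (l * (X w ^+ 2 - 1) - c))%:E <= 1)%E.
Proof.
move=> l4; apply: expectation_expRB; last exact: normal_sqr_mgf.
by apply: measurable_funM => //; apply: measurable_funB => //; exact: measurable_funX.
Qed.

End gaussian_steps.

(** Turns the value [h] of an envelope into one number [g] above all members of the
family. *)
Lemma root_envelope (R : realType) (m : nat) (h : R) : (0 < m)%N -> 1 <= h ->
  exists g, [/\ 1 <= g, g ^+ m = h &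
    forall s, (1 + Num.max 0 s) ^+ m <= h -> s <= g].
Proof.
move=> m0 h1; have h0 : 0 <= h by apply: le_trans h1.
pose g := h `^ m%:R^-1.
have mR : m%:R != 0 :> R by rewrite pnatr_eq0 -lt0n.
have gm : g ^+ m = h.
  by rewrite -powR_mulrn ?powR_ge0// -powRrM mulVf// powRr1.
have g0 : 0 <= g by exact: powR_ge0.
exists g; split=> //.
  by rewrite -(@ler_pXn2r _ m) ?nnegrE// expr1n gm.
move=> s; rewrite -gm ler_pXn2r ?nnegrE//; last first.
  by rewrite addr_ge0// le_max lexx.
have : s <= Num.max 0 s by rewrite le_max lexx orbT.
lra.
Qed.

Section driving_walks.
Context d (T : measurableType d) (R : realType) (P : probability T R).
Variable xi : nat -> {RV P >-> R}.
Hypothesis xi_iid : iid_standard_normal xi.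
Variables (sigma theta : nat -> R).
Hypothesis sigma_gt0 : forall k : nat, (1 <= k)%N -> 0 < sigma k.
Hypothesis sigma_nd : forall i j, (1 <= i)%N -> (i <= j)%N -> sigma i <= sigma j.

Let xi_indep : mutually_independent [set k | (1 <= k)%N] xi.
Proof. by case: xi_iid. Qed.

Let xiN k : (1 <= k)%N ->
  forall B : set R, measurable B -> distribution P (xi k) B = normal_prob 0 1 B.
Proof. by case: xi_iid => _; apply. Qed.

Lemma sqr_walk_envelope (kp : R) (e : bool) p : 0 <= kp -> kp <= 1 ->
  moment_envelope P
    (range (fun n w => \sum_(0 <= j < n) sqr_step kp e (xi j.+1 w)))
    p (envelope_mean R p).
Proof.
move=> kp0 kp1.
apply: (walk_envelope xi_indep (iota := succn) _ _
  (f := fun=> sqr_step kp e)) => // [|j|j]; first exact: succn_inj.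
- apply: measurable_funB => //; apply: measurable_funM => //.
  by apply: measurable_funM => //; exact: measurable_funB.
- rewrite /sqr_step; under eq_integral do rewrite mulrA.
  apply: (normal_sqr_step_mgf (xiN (ltn0Sn j))).
    by case: e; rewrite ?expr0 ?expr1; lra.
  by rewrite exprMn sqrr_sign; lra.
Qed.

Lemma forward_walk_envelope N0 (b : R) (e : bool) p :
  moment_envelope P
    (range (fun n w => \sum_(0 <= j < n)
       forward_step theta N0 b e j (xi (N0 + j.+1)%N w)))
    p (envelope_mean R p).
Proof.
apply: (walk_envelope xi_indep (iota := fun j => (N0 + j.+1)%N) _ _
  (f := forward_step theta N0 b e)) => [i j /addnI /succn_inj //|j|j|j].
- by rewrite addnS.
- apply: measurable_funB => //; apply: measurable_funM => //.
  by apply: measurable_funM => //; exact: measurable_funM.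
- rewrite /forward_step; under eq_integral do rewrite !mulrA.
  apply: (@normal_step_mgf _ _ _ _ (xi (N0 + j.+1)%N)).
    by apply: xiN; rewrite addnS.
  by rewrite !exprMn sqrr_sign mulr1.
Qed.

Lemma backward_walk_envelope N0 (dl : R) p : (1 <= N0)%N -> 0 < dl ->
  moment_envelope P
    [set fun w => \sum_(0 <= j < n)
       backward_step sigma theta N0 dl j (xi (N0 - j)%N w)
     | n in [set n | (n <= N0)%N]]
    p (envelope_mean R p).
Proof.
move=> N1 dl0.
(* The walk is stopped after N0 steps: beyond, the steps vanish and the indices
   only have to be new. *)
pose iota j := (if (j < N0)%N then N0 - j else j.+1)%N.
pose f j x := if (j < N0)%N then backward_step sigma theta N0 dl j x else 0.
apply: (@moment_envelopeS _ _ _ _ _ (range (walk xi iota f))).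
  move=> _ [n nN <-]; exists n => //; apply/funext => w.
  rewrite /walk !big_nat; apply: eq_bigr => j /andP[_ jn].
  by rewrite /iota /f (leq_trans jn nN).
apply: (walk_envelope xi_indep) => [i j|j|j|j].
- by rewrite /iota; case: (ltnP i N0) => ?; case: (ltnP j N0) => ?; lia.
- by rewrite /iota; case: (ltnP j N0) => ?; lia.
- rewrite /f; case: (j < N0)%N => //.
  apply: measurable_funM => //; apply: measurable_funB => //.
  apply: measurableT_comp => //; apply: measurable_funM => //.
  by apply: measurable_funM => //; exact: measurable_funM.
- rewrite /iota /f; have [jN|jN] := ltnP j N0; last first.
    under eq_integral do rewrite expR0.
    by rewrite integral_cst// mul1e probability_le1.
  have k1 : (1 <= N0 - j)%N by lia.
  have s0 : 0 < sigma N0 by exact: sigma_gt0.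
  rewrite /backward_step; set k := (N0 - j)%N in k1 *.
  have E w : dl / (2 * sigma N0 ^+ 2) *
     (- (2 * (sigma k * (theta k * xi k w))) - dl * theta k ^+ 2) =
     - (dl / sigma N0 ^+ 2 * sigma k * theta k) * xi k w -
     dl ^+ 2 * theta k ^+ 2 / (2 * sigma N0 ^+ 2).
    by field; rewrite gt_eqF.
  under eq_integral do rewrite E.
  apply: (normal_step_mgf (xiN k1)); rewrite sqrrN !exprMn exprVn.
  have ss : sigma k ^+ 2 <= sigma N0 ^+ 2.
    by rewrite lerXn2r ?nnegrE ?(ltW (sigma_gt0 _))// sigma_nd// leq_subr.
  have -> : dl ^+ 2 * theta k ^+ 2 / (2 * sigma N0 ^+ 2) =
     dl ^+ 2 / (sigma N0 ^+ 2) ^+ 2 * sigma N0 ^+ 2 * theta k ^+ 2 / 2.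
    by field; rewrite gt_eqF.
  rewrite ler_pM2r ?invr_gt0// ler_wpM2r ?sqr_ge0// ler_wpM2l//.
  by rewrite divr_ge0 ?sqr_ge0.
Qed.

End driving_walks.

(** * The risk bound *)

Section expected_noise_energy.
Context d (T : measurableType d) (R : realType) (P : probability T R).
Variable xi : nat -> {RV P >-> R}.
Hypothesis xi_iid : iid_standard_normal xi.
Variable sigma : nat -> R.

Lemma measurable_noise_energy N :
  measurable_fun setT (fun w => noise_energy sigma (fun k => xi k w) N).
Proof.
apply: measurable_sum => k; apply: measurable_funX; exact: measurable_funM.
Qed.

Lemma expected_noise_energy_ge N : ((noise_level sigma N)%:E <=
  \int[P]_w (noise_energy sigma (fun k => xi k w) N)%:E)%E.
Proof.
have E w : ((noise_energy sigma (fun k => xi k w) N)%:E =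
    \sum_(1 <= k < N.+1) (sigma k ^+ 2)%:E * (xi k w ^+ 2)%:E)%E.
  by rewrite /noise_energy -sumEFin; apply: eq_bigr => k _; rewrite exprMn EFinM.
under eq_integral do rewrite E.
have msq k : measurable_fun setT (fun w => (xi k w ^+ 2)%:E).
  by apply/measurable_EFinP; exact: measurable_funX.
rewrite ge0_integral_sum//; last 2 first.
- by move=> k; exact: emeasurable_funM.
- by move=> k w _; rewrite mule_ge0// lee_fin sqr_ge0.
rewrite -sumEFin [leLHS]big_nat_cond [leRHS]big_nat_cond.
apply: lee_sum => k /andP[/andP[k1 _] _].
rewrite ge0_integralZl//; last 2 first.
- by move=> w _; rewrite lee_fin sqr_ge0.
- by rewrite lee_fin sqr_ge0.
rewrite -[leLHS]mule1 lee_wpmul2l ?lee_fin ?sqr_ge0//.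
by apply: normal_sqr_ge1; case: xi_iid => _; apply.
Qed.

End expected_noise_energy.

Section risk_bound.
Context (R : realType) (beta : R) (sigma : nat -> R).
Hypothesis sigma_gt0 : forall k : nat, (1 <= k)%N -> 0 < sigma k.
Hypothesis sigma_poly : polynomial_hypothesis beta sigma.
Variables (A K : R) (m : nat).
Hypothesis A1 : 1 <= A.
Hypothesis A_bound : forall k, (1 <= k)%N ->
  k%:R * sigma k ^+ 2 <= A * noise_level sigma k.
Hypothesis K1 : 1 <= K.
Hypothesis m_gt0 : (0 < m)%N.
Variable dl : R.
Hypotheses (dl0 : 0 < dl) (dl8 : dl <= 8^-1).
Hypothesis K_bound : forall N a, (1 <= N)%N -> 1 <= a ->
  a * sigma N ^+ 2 / dl <= dl * noise_level sigma N + K * a ^+ m * budget beta sigma dl.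

Context d (T : measurableType d) (P : probability T R).
Variable xi : nat -> {RV P >-> R}.
Hypothesis xi_iid : iid_standard_normal xi.
Variable theta : nat -> R.
Hypothesis theta_l2 : (l2_sqnorm theta < +oo)%E.
Variable alpha : R.
Hypothesis alpha_gt1 : 1 < alpha.
Variable Nrhm : (nat -> R) -> nat.
Hypothesis Nrhm_min : rhm_bandwidth sigma xi alpha theta Nrhm.

Let pen N : R := (1 + alpha) * U0 sigma xi N.
Let Q : R := excess beta sigma A K m dl.

Let sigma_nd i j : (1 <= i)%N -> (i <= j)%N -> sigma i <= sigma j.
Proof.
have [_ _ s_nd _] := sigma_poly.
move=> i1 ij; have j1 := leq_trans i1 ij.
by rewrite -(@ler_pXn2r _ 2) ?nnegrE ?(ltW (sigma_gt0 _))// s_nd.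
Qed.

Let pen_ge0 N : 0 <= pen N.
Proof. by rewrite mulr_ge0 ?U0_ge0//; have ? := alpha_gt1; lra. Qed.

Let beta_ge0 : 0 <= beta. Proof. by case: sigma_poly. Qed.

Let dl1 : dl <= 1. Proof. by have ? := dl8; lra. Qed.

Let sum_rev (F : nat -> R) N n :
  \sum_(N.+1 <= k < (N + n).+1) F k = \sum_(0 <= j < n) F (N + n - j)%N.
Proof.
elim: n => [|n IH]; first by rewrite addn0 !big_geq.
rewrite [RHS]big_nat_recl// addnS big_nat_recr ?leq_addr//= IH addrC subn0.
by congr (_ + _); apply: eq_bigr => j _; rewrite subSS.
Qed.

Let sum_shift (F : nat -> R) N n :
  \sum_(N.+1 <= k < (N + n).+1) F k = \sum_(0 <= j < n) F (N + j.+1)%N.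
Proof.
elim: n => [|n IH]; first by rewrite addn0 !big_geq.
by rewrite [RHS]big_nat_recr//= -IH addnS big_nat_recr ?leq_addr.
Qed.

(** Where the envelope [H] of the five walks is finite, all of them stay below the
root of order [2 * m] of its value. There the minimum is attained, so that
[Nrhm] is a minimizer, and the deterministic oracle inequality applies with the
remainder [Q * fine (H w)]. *)
Lemma risk_pathwise N0 : (1 <= N0)%N ->
  exists H : T -> \bar R, [/\ measurable_fun setT H, forall w, (0 <= H w)%E,
    (\int[P]_w H w <= (5 * envelope_mean R (2 * m))%:E)%E &
    forall w, (H w < +oo)%E ->
    (1 - 2 * dl) *
      (tail_energy theta (Nrhm (observation sigma theta xi w)) +
       noise_energy sigma (xi^~ w) (Nrhm (observation sigma theta xi w))) +
    (1 + dl) * noise_energy sigma (xi^~ w) N0 <=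
    (1 + dl) ^+ 2 * (tail_energy theta N0 + noise_level sigma N0 + pen N0) +
    (1 + dl) * noise_level sigma N0 + 5 * (Q * fine (H w))].
Proof.
move=> N1; have ? := dl0; have ? := dl1; have ? := dl8; have ? := A1.
pose s1 := sigma 1 ^+ 2.
have s1_gt0 : 0 < s1 by rewrite exprn_gt0// sigma_gt0.
(* The scale of the forward walk; adding s1, which the remainder absorbs, keeps
   it positive when the tail energy vanishes. *)
pose b := Num.sqrt (tail_energy theta N0 + s1).
have tail0 := tail_energy_ge0 theta.
have bpos : 0 < tail_energy theta N0 + s1 by rewrite ltr_wpDl.
have b0 : 0 < b by rewrite sqrtr_gt0.
have b2 : b ^+ 2 = tail_energy theta N0 + s1 by rewrite sqr_sqrtr// ltW.
have kp0 : 0 <= dl / (4 * A) by rewrite divr_ge0//; lra.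
have kp1 : dl / (4 * A) <= 1 by rewrite ler_pdivrMr//; lra.
have [H [mH H0 FH HE]] :=
  moment_envelopeU (sqr_walk_envelope xi_iid false (2 * m) kp0 kp1)
  (moment_envelopeU (sqr_walk_envelope xi_iid true (2 * m) kp0 kp1)
  (moment_envelopeU (forward_walk_envelope xi_iid theta N0 b false (2 * m))
  (moment_envelopeU (forward_walk_envelope xi_iid theta N0 b true (2 * m))
    (backward_walk_envelope xi_iid theta sigma_gt0 sigma_nd (2 * m) N1 dl0)))).
exists H; split=> //.
  by apply: le_trans HE _; rewrite lee_fin; lra.
move=> w Hoo; set x := xi^~ w; set N := Nrhm _.
have Hw : H w = (fine (H w))%:E by rewrite fineK// ge0_fin_numE.
set h := fine (H w) in Hw *.
move: FH; set F := (_ `|` _) => FH.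
have {}FH f (Ff : F f) : (1 + Num.max 0 (f w)) ^+ (2 * m) <= h.
  by rewrite -lee_fin -Hw; exact: (FH f Ff w).
have h1 : 1 <= h.
  have := FH _ (or_introl (ex_intro2 _ _ 0%N I erefl)).
  by rewrite big_geq// maxxx addr0 expr1n.
have m2 : (0 < 2 * m)%N by rewrite muln_gt0.
have [g [g1 gh gS]] := root_envelope m2 h1.
have sqr_le n e :
    \sum_(0 <= j < n) sqr_step (dl / (4 * A)) e (x j.+1) <= g.
  apply: gS; apply: (FH (fun w =>
    \sum_(0 <= j < n) sqr_step (dl / (4 * A)) e (xi j.+1 w))).
  by case: e; [right; left; exists n|left; exists n].
have forward_le n e :
    \sum_(0 <= j < n) forward_step theta N0 b e j (x (N0 + j.+1)%N) <= g.
  apply: gS; apply: (FH (fun w =>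
    \sum_(0 <= j < n) forward_step theta N0 b e j (xi (N0 + j.+1)%N w))).
  by case: e; right; right; [right; left; exists n|left; exists n].
have backward_le n : (n <= N0)%N ->
    \sum_(0 <= j < n) backward_step sigma theta N0 dl j (x (N0 - j)%N) <= g.
  move=> nN; apply: gS; apply: (FH (fun w =>
    \sum_(0 <= j < n) backward_step sigma theta N0 dl j (xi (N0 - j)%N w))).
  by do 4!right; exists n.
have Q_ge : s1 <= Q * h.
  have Q1 : s1 <= Q by exact: excess_ge.
  by apply: (le_trans Q1); rewrite ler_peMr// (le_trans (ltW s1_gt0) Q1).
have fluctP M : (1 <= M)%N -> `|fluct sigma x M| <= dl * noise_level sigma M + Q * h.
  by move=> M1; rewrite -gh; apply: eta_pathwise.
have cross_fwd M : (N0 < M)%N ->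
    `|2 * (cross sigma theta x M - cross sigma theta x N0)| <=
    dl * (tail_energy theta N0 + s1) + dl * noise_level sigma M + Q * h.
  move=> NM; have -> : M = (N0 + (M - N0.+1).+1)%N by rewrite addnS -addSn subnKC.
  move: (M - N0.+1)%N => n; rewrite /cross.
  rewrite (@big_cat_nat _ _ _ N0.+1 1 (N0 + n.+1).+1)//=; last by rewrite ltnS leq_addr.
  rewrite addrAC subrr add0r sum_shift -b2 -gh.
  apply: forward_pathwise => // k.
  rewrite b2 -(sum_shift (fun i => theta i ^+ 2)).
  have := tail_energy_split theta_l2 (leq_addr k N0).
  by have := tail0 (N0 + k)%N; lra.
have cross_bwd M : (M <= N0)%N ->
    2 * (cross sigma theta x M - cross sigma theta x N0) <=
    dl * (tail_energy theta M - tail_energy theta N0) +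
    dl * noise_level sigma N0 + Q * h.
  move=> MN; rewrite (tail_energy_split theta_l2 MN) addrK -gh.
  have -> : cross sigma theta x M - cross sigma theta x N0 =
      - \sum_(M.+1 <= k < N0.+1) sigma k * (theta k * x k).
    by rewrite /cross [in X in _ - X](@big_cat_nat _ _ _ M.+1 1 N0.+1)//= opprD addNKr.
  have EN : N0 = (M + (N0 - M))%N by rewrite subnKC.
  rewrite mulrN {1 2}EN !sum_rev -EN.
  by apply: backward_pathwise => //; apply: backward_le; exact: leq_subr.
have tailE := @tail_energy_split _ _ theta_l2.
have critE M : rhm_criterion sigma xi alpha (observation sigma theta xi w) M =
    criterion sigma theta x pen M by [].
have [M M1 Mmin] : exists2 M, (1 <= M)%N & forall L, (1 <= L)%N ->
    criterion sigma theta x pen M <= criterion sigma theta x pen L.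
  apply: (criterion_attained pen_ge0 tail0 tailE dl0 dl8 fluctP
    cross_fwd cross_bwd) => //.
  exact: (noise_level_ge sigma_poly).
have [Nge1 Nmin'] : rhm_argmin sigma xi alpha (observation sigma theta xi w) N.
  by apply: Nrhm_min.1; exists M; split=> // L L1; rewrite !critE; exact: Mmin.
apply: (oracle_pathwise pen_ge0 tail0 tailE dl0 dl8 Q_ge fluctP
  cross_fwd cross_bwd) => //.
by rewrite -!critE; exact: Nmin'.
Qed.

(** Integration of [risk_pathwise]: the mean of [noise_energy N0] on the left is at
least [noise_level N0], and cancels the same term on the right. *)
Lemma risk_le N0 : (1 <= N0)%N ->
  ((1 - 2 * dl)%:E * rhm_risk sigma xi theta Nrhm <=
   ((1 + dl) ^+ 2 * (tail_energy theta N0 + noise_level sigma N0 +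
                     (1 + alpha) * U0 sigma xi N0) +
    25 * excess beta sigma A K m dl * envelope_mean R (2 * m))%:E)%E.
Proof.
move=> N1; have ? := dl0; have ? := dl8.
have [H [mH H0 HE HW]] := risk_pathwise N1.
rewrite -/(pen N0) -/Q; set R0 := _ + _ + pen N0 in HW *.
pose L w := l2_sqnorm (fun k => proj_estimator (observation sigma theta xi w)
  (Nrhm (observation sigma theta xi w)) k - theta k).
pose V w := noise_energy sigma (xi^~ w).
have LE w : L w = (tail_energy theta (Nrhm (observation sigma theta xi w)) +
    V w (Nrhm (observation sigma theta xi w)))%:E.
  exact: l2_loss.
have mV n : measurable_fun setT (fun w => V w n) by exact: measurable_noise_energy.
have V0 w n : 0 <= V w n by apply: sumr_ge0 => i _; exact: sqr_ge0.
have mL : measurable_fun setT L.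
  rewrite (_ : L = fun w => (tail_energy theta (Nrhm (observation sigma theta xi w)) +
    V w (Nrhm (observation sigma theta xi w)))%:E); last exact/funext.
  apply: (@measurable_nat_index _ _ _ _ (fun n w => (tail_energy theta n + V w n)%:E)).
    by move=> n; apply/measurable_EFinP; exact: measurable_funD.
  by case: Nrhm_min.
have L0 w : (0 <= L w)%E by rewrite LE lee_fin addr_ge0// tail_energy_ge0.
have Q0 : 0 <= Q.
  by apply: le_trans (excess_ge _ _ A1 K1 dl0 dl1 beta_ge0); exact: sqr_ge0.
have S0 : 0 <= noise_level sigma N0 by apply: sumr_ge0 => i _; exact: sqr_ge0.
have R00 : 0 <= R0 by rewrite /R0 !addr_ge0 ?tail_energy_ge0 ?pen_ge0.
have c20 : 0 <= (1 + dl) ^+ 2 * R0 + (1 + dl) * noise_level sigma N0.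
  by rewrite addr_ge0 ?mulr_ge0 ?sqr_ge0//; lra.
pose f1 w := ((1 - 2 * dl)%:E * L w + (1 + dl)%:E * (V w N0)%:E)%E.
pose f2 w := (((1 + dl) ^+ 2 * R0 + (1 + dl) * noise_level sigma N0)%:E +
   (5 * Q)%:E * H w)%E.
have mf1 : measurable_fun setT f1.
  apply: emeasurable_funD; first exact: emeasurable_funM.
  by apply: emeasurable_funM => //; exact/measurable_EFinP.
have mf2 : measurable_fun setT f2.
  by apply: emeasurable_funD => //; exact: emeasurable_funM.
have c1 : (0 <= (1 - 2 * dl)%:E)%E by rewrite lee_fin; lra.
have c2 : (0 <= (1 + dl)%:E)%E by rewrite lee_fin; lra.
have c3 : (0 <= (5 * Q)%:E)%E by rewrite lee_fin mulr_ge0.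
have Hfin : {ae P, forall w, setT w -> H w \is a fin_num}.
  apply: (integrable_ae measurableT); apply/integrableP; split=> //.
  under eq_integral do rewrite gee0_abs//.
  by apply: le_lt_trans HE _; rewrite ltry.
have f12 : (\int[P]_w f1 w <= \int[P]_w f2 w)%E.
  apply: ae_ge0_le_integral => //.
  - by move=> w _; rewrite adde_ge0// mule_ge0// lee_fin.
  - by move=> w _; rewrite adde_ge0// ?lee_fin// mule_ge0.
  apply: filterS Hfin => w /(_ I) Hw _.
  rewrite /f1 /f2 -(fineK Hw) LE -!EFinM -!EFinD lee_fin -(mulrA 5).
  have Hlt : (H w < +oo)%E by rewrite -ge0_fin_numE.
  exact: HW.
have mVE : measurable_fun setT (fun w => (V w N0)%:E) by exact/measurable_EFinP.
have VE0 w : setT w -> (0 <= (V w N0)%:E)%E by rewrite lee_fin.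
have E1 : (\int[P]_w f1 w = (1 - 2 * dl)%:E * rhm_risk sigma xi theta Nrhm +
    (1 + dl)%:E * \int[P]_w (V w N0)%:E)%E.
  rewrite ge0_integralD//.
  - by rewrite !ge0_integralZl.
  - by move=> w _; rewrite mule_ge0.
  - exact: emeasurable_funM.
  - by move=> w wT; rewrite mule_ge0// VE0.
  - exact: emeasurable_funM.
have E2 : (\int[P]_w f2 w <= ((1 + dl) ^+ 2 * R0 + (1 + dl) * noise_level sigma N0)%:E +
   (5 * Q)%:E * (5 * envelope_mean R (2 * m))%:E)%E.
  rewrite ge0_integralD//.
  - rewrite integral_cst// [X in (_ * X)%E](@probability_setT _ _ _ P) mule1 leeD2l//.
    rewrite ge0_integralZl//; exact: lee_wpmul2l.
  - by move=> w _; rewrite mule_ge0.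
  - exact: emeasurable_funM.
have := le_trans f12 E2; rewrite E1 => {}f12.
have EV := @expected_noise_energy_ge _ _ _ _ _ xi_iid sigma N0.
have := le_trans (leeD2l _ (lee_wpmul2l c2 EV)) f12.
rewrite -!EFinM -EFinD -leeBrDr// -EFinB => /le_trans; apply.
rewrite lee_fin le_eqVlt; apply/orP; left; apply/eqP; ring.
Qed.

End risk_bound.

(** * The oracle inequality *)

Lemma budgetZ (R : realType) (beta : R) (sigma : nat -> R) (c gamma : R) :
  0 < c -> 0 < gamma ->
  budget beta sigma (gamma / c) =
  c `^ (4 * beta + 1) * sigma 1 ^+ 2 * (gamma `^ (4 * beta + 1))^-1.
Proof.
move=> c0 g0; rewrite /budget powRM ?invr_ge0 ?(ltW c0) ?(ltW g0)//.
have -> : c^-1 `^ (4 * beta + 1) = (c `^ (4 * beta + 1))^-1.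
  by rewrite -powR_inv1 ?(ltW c0)// -powRrM mulN1r powRN.
by rewrite invfM invrK; ring.
Qed.

Lemma sharp_constant (R : realFieldType) (gamma : R) : 0 < gamma -> gamma <= 1 ->
  (1 + gamma / 8) ^+ 2 <= (1 + gamma) * (1 - 2 * (gamma / 8)).
Proof.
move=> g0 g1; have : 0 <= gamma * (1 - gamma) by rewrite mulr_ge0//; lra.
rewrite expr2; lra.
Qed.

Theorem theorem1 (R : realType) (beta : R) (sigma : nat -> R)
    (sigma_gt0 : forall k : nat, (1 <= k)%N -> 0 < sigma k)
    (sigma_poly : polynomial_hypothesis beta sigma) :
  exists Cstar gamma0 : R, 0 < Cstar /\ 0 < gamma0 /\
    forall (d : measure_display) (T : measurableType d) (P : probability T R)
      (xi : nat -> {RV P >-> R}), iid_standard_normal xi ->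
    forall theta : nat -> R, (l2_sqnorm theta < +oo)%E ->
    forall gamma : R, 0 < gamma -> gamma <= gamma0 ->
    forall alpha : R, 1 < alpha ->
    forall Nrhm : (nat -> R) -> nat, rhm_bandwidth sigma xi alpha theta Nrhm ->
    (rhm_risk sigma xi theta Nrhm <=
       (1 + gamma)%:E *
         ereal_inf [set R_rhm sigma xi alpha theta N | N in [set N | (1 <= N)%N]]
       + (Cstar * sigma 1%N ^+ 2 *
           ((gamma `^ (4 * beta + 1))^-1 + (alpha - 1)^-1))%:E)%E.
Proof.
have [A A1 A_bound] := index_sqr_le_noise_level sigma_poly.
have [K K1 K_bound] := young_noise_level sigma_gt0 sigma_poly.
have [beta_ge0 _ _ _] := sigma_poly.
pose m := (Num.truncn (2 * beta + 1)).+1.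
have bm : 2 * beta + 1 <= m%:R by exact/ltW/truncnS_gt.
pose C := 25 * (K * (64 * A) ^+ m * 8 `^ (4 * beta + 1)) * envelope_mean R (2 * m).
have C0 : 0 <= C.
  rewrite /C !mulr_ge0 ?exprn_ge0 ?powR_ge0 ?envelope_mean_ge0//; lra.
have s0 : 0 < sigma 1 ^+ 2 by rewrite exprn_gt0// sigma_gt0.
(* With [dl = gamma / 8] the factor [(1 - 2 * dl)^-1] of the remainder is at most 2,
   and adding 1 makes the constant positive. *)
exists (2 * C + 1), 1; split; first by lra.
split=> // d T P xi xi_iid theta theta_l2 gamma g0 g1 alpha a1 Nrhm HN.
pose dl := gamma / 8.
have dl0 : 0 < dl by rewrite divr_gt0.
have dl8 : dl <= 8^-1 by rewrite /dl; lra.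
have dl1 : dl <= 1 by lra.
have Kb N a (N1 : (1 <= N)%N) (age1 : 1 <= a) := K_bound m N dl a bm N1 dl0 dl1 age1.
have key N0 N1 := risk_le sigma_gt0 sigma_poly A1 A_bound K1 (ltn0Sn _) dl0 dl8 Kb
  xi_iid theta_l2 a1 HN (N0 := N0) N1.
pose Gb := (gamma `^ (4 * beta + 1))^-1.
have Gb0 : 0 < Gb by rewrite invr_gt0 powR_gt0.
have QE : 25 * excess beta sigma A K m dl * envelope_mean R (2 * m) =
    C * sigma 1 ^+ 2 * Gb.
  by rewrite /excess /dl budgetZ// /C /Gb; ring.
have CG0 : 0 <= C * sigma 1 ^+ 2 * Gb.
  by rewrite mulr_ge0 ?(ltW Gb0)// mulr_ge0 ?(ltW s0).
pose r N := tail_energy theta N + noise_level sigma N + (1 + alpha) * U0 sigma xi N.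
have rE N : R_rhm sigma xi alpha theta N = (r N)%:E.
  by rewrite /R_rhm tail_energyE.
have r0 N : 0 <= r N.
  rewrite /r !addr_ge0 ?tail_energy_ge0//.
    by apply: sumr_ge0 => i _; exact: sqr_ge0.
  by rewrite mulr_ge0 ?U0_ge0//; lra.
pose Z := 2 * C * sigma 1 ^+ 2 * Gb.
have risk0 : (0 <= rhm_risk sigma xi theta Nrhm)%E.
  apply: integral_ge0 => w _; rewrite nneseries_ge0// => k _ _.
  by rewrite lee_fin sqr_ge0.
have main N : (1 <= N)%N ->
    (rhm_risk sigma xi theta Nrhm <= ((1 + gamma) * r N + Z)%:E)%E.
  move=> N1; have := key N N1; rewrite QE -/(r N).
  case: (rhm_risk _ _ _ _) risk0 => [v| |//]; last first.
    by move=> _; rewrite gt0_muley ?lte_fin//; lra.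
  rewrite -EFinM !lee_fin => v0 h.
  have e0 : 0 < 1 - 2 * dl by lra.
  rewrite -(ler_pM2l e0); apply: le_trans h _.
  rewrite [leRHS]mulrDr lerD//.
    by rewrite mulrA ler_wpM2r// mulrC; exact: sharp_constant.
  have -> : (1 - 2 * dl) * Z = (2 * (1 - 2 * dl)) * (C * sigma 1 ^+ 2 * Gb).
    by rewrite /Z; ring.
  by rewrite ler_peMl//; lra.
set I := ereal_inf _.
have : (rhm_risk sigma xi theta Nrhm <= (1 + gamma)%:E * I + Z%:E)%E.
  have [v vE] : exists v, rhm_risk sigma xi theta Nrhm = v%:E.
    exists (fine (rhm_risk sigma xi theta Nrhm)); rewrite fineK// ge0_fin_numE//.
    by apply: le_lt_trans (main 1%N isT) _; rewrite ltry.
  have vI : (((v - Z) / (1 + gamma))%:E <= I)%E.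
    apply: le_ereal_inf_tmp => _ [N N1 <-]; rewrite rE lee_fin ler_pdivrMr; last by lra.
    by have := main N N1; rewrite vE lee_fin; lra.
  rewrite vE; case: I vI => [i| |//].
    rewrite -EFinM -EFinD !lee_fin ler_pdivrMr; last by lra.
    by lra.
  by move=> _; rewrite gt0_muley ?lte_fin ?leey//; lra.
move=> /le_trans; apply; rewrite leeD2l// lee_fin /Z -/Gb.
have a0 : 0 <= (alpha - 1)^-1 by rewrite invr_ge0; lra.
rewrite mulrDr -[leLHS]addr0 lerD//; last first.
  by rewrite mulr_ge0// mulr_ge0 ?(ltW s0)//; lra.
by rewrite ler_wpM2r ?(ltW Gb0)// ler_wpM2r ?(ltW s0)//; lra.
Qed.
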